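(* (The hook theorem for $\#$-superalgebras) Let $F$ be a field of characteristic zero and $A$ a $\#$-superalgebra over $F$. If $A$ is a PI-algebra, then there exist integers $d_i,l_i\ge0$, $i=1,2,3,4$, such that for every $\langle n\rangle=(n_1,n_2,n_3,n_4)$ the $\langle n\rangle$-th $\#$-cocharacter of $A$ is contained in the quadruple hook $\mathcal H_{\langle d,l\rangle}=(\mathcal H(d_1,l_1),\mathcal H(d_2,l_2),\mathcal H(d_3,l_3),\mathcal H(d_4,l_4))$, that is, $$\chi_{\langle n\rangle}(A)=\sum_{\substack{\langle\lambda\rangle\vdash\langle n\rangle\\ \langle\lambda\rangle\in\mathcal H_{\langle d,l\rangle}}}m_{\langle\lambda\rangle}\chi_{\langle\lambda\rangle}.$$
   Context: All algebras are associative over $F$. A superalgebra is $A=A_0\oplus A_1$ with $A_iA_j\subseteq A_{(i+j)\bmod2}$. A superinvolution is an $F$-linear $\#$ with $A_i^\#\subseteq A_i$, $(c^\#)^\#=c$, $(ab)^\#=(-1)^{\deg a\deg b}b^\#a^\#$ for homogeneous $a,b$; a graded involution is $F$-linear $\#$ with $A_i^\#\subseteq A_i$, $(c^\#)^\#=c$, $(ab)^\#=b^\#a^\#$; a $\#$-superalgebra carries one of these. $A_i^\pm=\{a\in A_i:a^\#=\pm a\}$. PI-algebra: satisfies a nontrivial ordinary polynomial identity. $\mathcal F$ is the free non-unital associative algebra on $y_{i,j}$ (symmetric) and $z_{i,j}$ (skew), $i\in\{0,1\}$, $j\ge1$, variables with first index $i$ of $\mathbb Z_2$-degree $i$, with the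 induced superinvolution/graded involution. A $\#$-superidentity of $A$ is $f\in\mathcal F$ vanishing under all substitutions $y_{0,j}\mapsto A_0^+$, $z_{0,j}\mapsto A_0^-$, $y_{1,j}\mapsto A_1^+$, $z_{1,j}\mapsto A_1^-$; $Id_2^\#(A)$ is their set. $P_{\langle n\rangle}$ is the span of monomials multilinear in $y_{0,1..n_1},z_{0,1..n_2},y_{1,1..n_3},z_{1,1..n_4}$, a left module over $S_{\langle n\rangle}=S_{n_1}\times\cdots\times S_{n_4}$ acting by permuting second indices of each of the four types separately. A multipartition $\langle\lambda\rangle\vdash\langle n\rangle$ is $(\lambda(1),\dots,\lambda(4))$ with $\lambda(i)\vdash n_i$; $\chi_{\langle\lambda\rangle}=\chi_{\lambda(1)}\otimes\cdots\otimes\chi_{\lambda(4)}$. The $\langle n\rangle$-th $\#$-cocharacter $\chi_{\langle n\rangle}(A)=\sum m_{\langle\lambda\rangle}\chi_{\langle\lambda\rangle}$ is the $S_{\langle n\rangle}$-character of $P_{\langle n\rangle}/(P_{\langle n\rangle}\cap Id_2^\#(A))$. For $d,l\ge0$, $\mathcal H(d,l)$ is the set of partitions $\lambda=(\lambda_1,\lambda_2,\dots)$ with $\lambda_{d+1}\le l$; $\langle\lambda\rangle\in\mathcal H_{\langle d,l\rangle}$ means $\lambda(i)\in\mathcal H(d_i,l_i)$ for $i=1,\dots,4$. *)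

(* Defs.v *)
From mathcomp Require Import all_boot all_order all_algebra all_fingroup.
From mathcomp Require Import mxrepresentation.
Set Implicit Arguments. Unset Strict Implicit. Unset Printing Implicit Defensive.
Import GRing.Theory.
Local Open Scope ring_scope.

(* (Possibly non-unital) associative #-superalgebras over F.                 *)
(* A is an F-vector space with a bilinear associative product [mul];        *)
(* [Agr false], [Agr true] are the homogeneous components A_0, A_1;         *)
(* [sh] is the map #; [super = true] means # is a superinvolution,          *)
(* [super = false] means # is a graded involution.                          *)

Definition is_assoc_algebra (F : fieldType) (A : lmodType F)
  (mul : A -> A -> A) : Prop :=
  [/\ forall (a : F) (x y z : A), mul (a *: x + y) z = a *: mul x z + mul y z,
      forall (a : F) (x y z : A), mul x (a *: y + z) = a *: mul x y + mul x z &
      forall x y z : A, mul x (mul y z) = mul (mul x y) z].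

Definition is_subspace (F : fieldType) (A : lmodType F) (S : A -> Prop) :=
  S 0 /\ forall (a : F) (x y : A), S x -> S y -> S (a *: x + y).

Definition is_superalgebra (F : fieldType) (A : lmodType F)
  (mul : A -> A -> A) (Agr : bool -> A -> Prop) : Prop :=
  [/\ is_assoc_algebra mul,
      forall i, is_subspace (Agr i),
      forall x : A, exists x0 x1, [/\ Agr false x0, Agr true x1 & x = x0 + x1],
      forall x : A, Agr false x -> Agr true x -> x = 0 &
      forall (i j : bool) (x y : A), Agr i x -> Agr j y -> Agr (addb i j) (mul x y)].

Definition is_sharp (F : fieldType) (A : lmodType F)
  (mul : A -> A -> A) (Agr : bool -> A -> Prop) (super : bool) (sh : A -> A) : Prop :=
  [/\ forall (a : F) (x y : A), sh (a *: x + y) = a *: sh x + sh y,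
      forall (i : bool) (x : A), Agr i x -> Agr i (sh x),
      forall x : A, sh (sh x) = x &
      forall (i j : bool) (x y : A), Agr i x -> Agr j y ->
        sh (mul x y) = (if [&& super, i & j] then -1 else 1) *: mul (sh y) (sh x)].

Definition is_sharp_superalgebra (F : fieldType) (A : lmodType F)
  (mul : A -> A -> A) (Agr : bool -> A -> Prop) (super : bool) (sh : A -> A) :=
  is_superalgebra mul Agr /\ is_sharp mul Agr super sh.

(* non-unital product of a (nonempty) word; the empty product is set to 0 *)
Definition wprod (F : fieldType) (A : lmodType F) (mul : A -> A -> A)
  (s : seq A) : A :=
  if s is a :: s' then foldl mul a s' else 0.

(* PI-algebra: A satisfies a nontrivial ordinary polynomial identity.        *)
(* A polynomial of the free non-unital algebra F<x_0, x_1, ...> is given by  *)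
(* a duplicate-free list S of nonempty words (seq of variable indices) and   *)
(* coefficients c; it is nonzero iff some c w, w \in S, is nonzero.          *)
Definition is_PI (F : fieldType) (A : lmodType F) (mul : A -> A -> A) : Prop :=
  exists (S : seq (seq nat)) (c : seq nat -> F),
    [/\ uniq S, all (fun w => w != [::]) S,
        has (fun w => c w != 0) S &
        forall x : nat -> A,
          \sum_(w <- S) c w *: wprod mul (map x w) = 0].

(* Multilinear polynomials P_<n>.                                            *)
(* The variables of P_<n> form the finite type [Var n1 n2 n3 n4]:            *)
(*   inl (inl (inl j)) = y_{0,j}, inl (inl (inr j)) = z_{0,j},               *)
(*   inl (inr j) = y_{1,j},       inr j = z_{1,j}.                           *)
(* A multilinear monomial is a word in which every variable occurs exactly   *)
(* once; it is indexed by a permutation s of Var, the word being             *)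
(* [seq s v | v <- enum Var].  We index monomials by 'I_(#|{perm Var}|).     *)
(* An element of P_<n> is a row vector of coefficients.                       *)
Definition Var (n1 n2 n3 n4 : nat) : finType :=
  ((('I_n1 + 'I_n2) + 'I_n3) + 'I_n4)%type.

Definition vdeg n1 n2 n3 n4 (v : Var n1 n2 n3 n4) : bool :=
  match v with inl (inl _) => false | _ => true end.

Definition vskew n1 n2 n3 n4 (v : Var n1 n2 n3 n4) : bool :=
  match v with
  | inl (inl (inl _)) => false | inl (inl (inr _)) => true
  | inl (inr _) => false | inr _ => true end.

Definition nmon n1 n2 n3 n4 := #|{perm Var n1 n2 n3 n4}|.

Definition monword n1 n2 n3 n4 (i : 'I_(nmon n1 n2 n3 n4)) : seq (Var n1 n2 n3 n4) :=
  [seq (enum_val i : {perm Var n1 n2 n3 n4}) v | v <- enum (Var n1 n2 n3 n4)].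

Definition meval (F : fieldType) (A : lmodType F) (mul : A -> A -> A)
  n1 n2 n3 n4 (f : 'rV[F]_(nmon n1 n2 n3 n4)) (s : Var n1 n2 n3 n4 -> A) : A :=
  \sum_i f 0 i *: wprod mul (map s (monword i)).

Definition admissible (F : fieldType) (A : lmodType F)
  (Agr : bool -> A -> Prop) (sh : A -> A)
  n1 n2 n3 n4 (s : Var n1 n2 n3 n4 -> A) : Prop :=
  forall v, Agr (vdeg v) (s v) /\ sh (s v) = (if vskew v then - s v else s v).

Definition is_sharp_id (F : fieldType) (A : lmodType F) (mul : A -> A -> A)
  (Agr : bool -> A -> Prop) (sh : A -> A) n1 n2 n3 n4
  (f : 'rV[F]_(nmon n1 n2 n3 n4)) : Prop :=
  forall s : Var n1 n2 n3 n4 -> A, admissible Agr sh s -> meval mul f s = 0.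

Definition vact n1 n2 n3 n4 (t1 : 'S_n1) (t2 : 'S_n2) (t3 : 'S_n3) (t4 : 'S_n4)
  (v : Var n1 n2 n3 n4) : Var n1 n2 n3 n4 :=
  match v with
  | inl (inl (inl j)) => inl (inl (inl (t1 j)))
  | inl (inl (inr j)) => inl (inl (inr (t2 j)))
  | inl (inr j) => inl (inr (t3 j))
  | inr j => inr (t4 j) end.

(* matrix of the action on P_<n>: the monomial i is sent to the monomial j   *)
(* obtained by renaming each variable v into vact v (row-vector convention) *)
Definition Pact (F : fieldType) n1 n2 n3 n4
  (t1 : 'S_n1) (t2 : 'S_n2) (t3 : 'S_n3) (t4 : 'S_n4) :
  'M[F]_(nmon n1 n2 n3 n4) :=
  \matrix_(i, j) ([forall v, (enum_val j : {perm Var n1 n2 n3 n4}) v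
                    == vact t1 t2 t3 t4 ((enum_val i : {perm _}) v)] %:R).

(* <n>-th #-cocharacter of A at (t1,...,t4): the trace of the action on the *)
(* quotient P_<n> / (P_<n> \cap Id), where W is a matrix whose row space is  *)
(* P_<n> \cap Id_2^#(A).                                                     *)
Definition cochar (F : fieldType) n1 n2 n3 n4 (W : 'M[F]_(nmon n1 n2 n3 n4))
  (t1 : 'S_n1) (t2 : 'S_n2) (t3 : 'S_n3) (t4 : 'S_n4) : F :=
  \tr (in_factmod W (val_factmod (U := W) 1%:M *m Pact F t1 t2 t3 t4)).

Definition is_partition (m : nat) (la : seq nat) : bool :=
  [&& sorted (fun a b : nat => (b <= a)%N) la, all (fun a : nat => (0 < a)%N) la & (sumn la == m)%N].

(* la \in H(d, l)  iff  la_{d+1} <= l  (la_{d+1} = nth 0 la d, 0 if absent) *)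
Definition in_hook (d l : nat) (la : seq nat) : bool := (nth 0 la d <= l)%N.

(* (row, column) of the k-th box (0-based, row reading order) of the         *)
(* canonical Young tableau of shape la                                      *)
Fixpoint box_pos (la : seq nat) (k : nat) : nat * nat :=
  match la with
  | [::] => (0%N, k)
  | a :: la' => if (k < a)%N then (0%N, k)
                else let rc := box_pos la' (k - a) in (rc.1.+1, rc.2) end.

Definition row_stab (m : nat) (la : seq nat) : {set 'S_m} :=
  [set p : 'S_m | [forall k : 'I_m, (box_pos la (p k)).1 == (box_pos la k).1]].
Definition col_stab (m : nat) (la : seq nat) : {set 'S_m} :=
  [set q : 'S_m | [forall k : 'I_m, (box_pos la (q k)).2 == (box_pos la k).2]].

Definition ngr (m : nat) := #|{perm 'I_m}|.

Definition regmx (F : fieldType) (m : nat) (g : 'S_m) : 'M[F]_(ngr m) :=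
  \matrix_(i, j) ((enum_val i * g == enum_val j :> 'S_m)%g %:R).

Definition young_sym (F : fieldType) (m : nat) (la : seq nat) : 'rV[F]_(ngr m) :=
  \row_j \sum_(p in row_stab m la) \sum_(q in col_stab m la)
          ((p * q == enum_val j :> 'S_m)%g %:R * (-1) ^+ (odd_perm q)).

(* Specht module: the (right) ideal e_T F[S_m], as a row space *)
Definition specht (F : fieldType) (m : nat) (la : seq nat) : 'M[F]_(ngr m) :=
  \matrix_(i < ngr m) (young_sym F m la *m regmx F (enum_val i)).

Definition irrchar (F : fieldType) (m : nat) (la : seq nat) (g : 'S_m) : F :=
  let U := specht F m la in
  \tr (in_submod U (val_submod (U := U) 1%:M *m regmx F g)).

Definition mpart := (seq nat * seq nat * seq nat * seq nat)%type.

Definition is_mpart (n1 n2 n3 n4 : nat) (la : mpart) : bool :=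
  let: (l1, l2, l3, l4) := la in
  [&& is_partition n1 l1, is_partition n2 l2, is_partition n3 l3 & is_partition n4 l4].

Definition in_mhook (d1 l1 d2 l2 d3 l3 d4 l4 : nat) (la : mpart) : bool :=
  let: (a1, a2, a3, a4) := la in
  [&& in_hook d1 l1 a1, in_hook d2 l2 a2, in_hook d3 l3 a3 & in_hook d4 l4 a4].

Definition mchar (F : fieldType) n1 n2 n3 n4 (la : mpart)
  (t1 : 'S_n1) (t2 : 'S_n2) (t3 : 'S_n3) (t4 : 'S_n4) : F :=
  let: (a1, a2, a3, a4) := la in
  irrchar F a1 t1 * irrchar F a2 t2 * irrchar F a3 t3 * irrchar F a4 t4.

(* Main.v *)
Require Import Defs.
From mathcomp Require Import all_boot all_order all_algebra all_fingroup.
From mathcomp Require Import mxrepresentation zify ring.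
Set Implicit Arguments. Unset Strict Implicit. Unset Printing Implicit Defensive.
Import GRing.Theory.
Local Open Scope ring_scope.

(* The grading and the map # play no role beyond restricting the admissible
   substitutions: every multilinear ordinary identity of A, with its variables
   renamed, lies in Id_2^#(A), and the factors S_{n_i} only rename variables.

   Let e_la = R^+ C^- be the Young symmetrizer of a tableau.  Von Neumann's
   lemma gives e_la x e_la in F e_la, and e_la x e_mu = 0 for all x or
   e_mu x e_la = 0 for all x when la <> mu.  The conjugation averages of the
   e_la are orthogonal central elements, as numerous as the conjugacy classes,
   hence they span the class functions; expanding 1 in them gives, for every
   representation rho, tr rho(t) = sum_la rank rho(e_la) chi_la(t), and
   likewise for four commuting representations.  So it suffices that e_la
   annihilates P_<n> modulo identities as soon as one component of the
   multipartition contains a large rectangle.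

   By averaging over row and column permutations it is enough to treat the
   symmetrizer e of the rectangle X alone, acting on a monomial w.  The letters
   of w outside X form at most #|X| + 1 blocks, so the evaluations of g w, with
   g in Sym X, are those of multilinear words of degree N <= 2 #|X| + 1, and by
   Latyshev's argument they span a space of dimension at most C^N.  On the other
   hand the translates of e by the permutations preserving the antidiagonals
   are independent, and there are superexponentially many of them.  Hence some
   nonzero element of the right ideal e F[Sym X] annihilates w, and by
   irreducibility e does. *)


(** * Multilinear identities and codimension growth *)

Section WordProducts.

Variables (F : fieldType) (A : lmodType F) (mul : A -> A -> A).
Hypothesis mul_alg : is_assoc_algebra mul.

Lemma mulDl_alg x y z : mul (x + y) z = mul x z + mul y z.
Proof. by case: mul_alg => /(_ 1 x y z); rewrite !scale1r. Qed.

Lemma mulDr_alg x y z : mul x (y + z) = mul x y + mul x z.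
Proof. by case: mul_alg => _ /(_ 1 x y z); rewrite !scale1r. Qed.

Lemma mul0l_alg z : mul 0 z = 0.
Proof. by apply: (addrI (mul 0 z)); rewrite -mulDl_alg !addr0. Qed.

Lemma mul0r_alg z : mul z 0 = 0.
Proof. by apply: (addrI (mul z 0)); rewrite -mulDr_alg !addr0. Qed.

Lemma mulZr_alg a x y : mul x (a *: y) = a *: mul x y.
Proof. by case: mul_alg => _ /(_ a x y 0); rewrite !addr0 mul0r_alg addr0. Qed.

Lemma mul_suml_alg I r (P : pred I) (f : I -> A) z :
  mul (\sum_(i <- r | P i) f i) z = \sum_(i <- r | P i) mul (f i) z.
Proof. exact: (big_morph (mul^~ z) (fun x y => mulDl_alg x y z) (mul0l_alg z)). Qed.

Lemma mul_sumr_alg I r (P : pred I) (f : I -> A) z :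
  mul z (\sum_(i <- r | P i) f i) = \sum_(i <- r | P i) mul z (f i).
Proof. exact: (big_morph (mul z) (mulDr_alg z) (mul0r_alg z)). Qed.

Lemma wprod_cons x s : s != [::] -> wprod mul (x :: s) = mul x (wprod mul s).
Proof.
case: s => [//|y s] _ /=; elim: s y => [//|z s IHs] y /=.
by rewrite -IHs; case: mul_alg => _ _ ->.
Qed.

Lemma wprod_cat s t :
  t != [::] -> wprod mul (s ++ t) = foldr mul (wprod mul t) s.
Proof.
move=> t0; elim: s => //= x s IHs; rewrite -IHs -wprod_cons //.
by case: s {IHs} t0 => //; case: t.
Qed.

Lemma wprod_flatten (bs : seq (seq A)) :
  all (predC1 [::]) bs -> wprod mul (flatten bs) = wprod mul (map (wprod mul) bs).
Proof.
elim: bs => [//|b bs IHbs] /= /andP[b0 bs0].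
case: bs bs0 IHbs => [|c bs] bs0 IHbs; first by rewrite cats0.
rewrite wprod_cat; last by case: c bs0 {IHbs}.
rewrite IHbs // [RHS]wprod_cons //.
case: b b0 => // x b _; set a := wprod _ _.
have ->: foldr mul a (x :: b) = wprod mul ((x :: b) ++ [:: a]).
  by rewrite wprod_cat.
elim: b x => [|y b IHb] x //; rewrite [LHS]wprod_cons // IHb.
by rewrite [in RHS]wprod_cons //; case: mul_alg => _ _ ->.
Qed.

Lemma foldr_mul_sum I r (P : pred I) (c : I -> F) (f : I -> A) s :
  foldr mul (\sum_(i <- r | P i) c i *: f i) s
  = \sum_(i <- r | P i) c i *: foldr mul (f i) s.
Proof.
elim: s => //= x s ->; rewrite mul_sumr_alg.
by apply: eq_bigr => i _; rewrite mulZr_alg.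
Qed.

Fixpoint words d n : seq (seq 'I_d) :=
  if n is n'.+1 then [seq x :: t | x <- enum 'I_d, t <- words d n'] else [:: [::]].

Lemma mem_words d n s : (s \in words d n) = (size s == n).
Proof.
elim: n s => [|n IHn] s /=; first by rewrite inE size_eq0.
apply/allpairsP/idP => [[[x t] /= [_ tn ->]]|].
  by rewrite /= eqSS -IHn.
by case: s => // x t /=; rewrite eqSS -IHn => tn; exists (x, t); rewrite mem_enum.
Qed.

Lemma words_uniq d n : uniq (words d n).
Proof.
elim: n => //= n IHn; apply: allpairs_uniq => //; first exact: enum_uniq.
by move=> [x s] [y t] _ _ /= [-> ->].
Qed.

(** Distributivity: choosing one summand for each letter of [v] amounts to choosing a word [s] of
    the same length, matched with [v] letter by letter. *)
Lemma wprod_subst_sum d (P : 'I_d -> nat -> bool) (z : 'I_d -> A) (v : seq nat) :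
  wprod mul [seq \sum_(p | P p i) z p | i <- v]
  = \sum_(s <- words d (size v) | all2 P s v) wprod mul (map z s).
Proof.
elim: v => [|i v IHv]; first by rewrite big_cons big_nil /= addr0.
rewrite big_mkcond big_allpairs_dep big_enum.
case: v IHv => [|j v] IHv.
  rewrite /= big_mkcond; apply: eq_bigr => p _.
  by rewrite big_cons big_nil /= andbT addr0.
rewrite map_cons wprod_cons // IHv mul_suml_alg big_mkcond; apply: eq_bigr => p _.
rewrite mul_sumr_alg [in RHS]big_seq [in LHS]big_seq_cond.
rewrite [LHS](_ : _ = \sum_(s <- words d (size (j :: v)) | s \in words d (size (j :: v)))
   if P p i && all2 P s (j :: v) then mul (z p) (wprod mul (map z s)) else 0).
  apply: eq_bigr => s; rewrite mem_words => /eqP ss.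
  have s0 : map z s != [::] by case: s ss.
  by rewrite -[all2 P (p :: s) _]/(P p i && all2 P s (j :: v)) map_cons wprod_cons.
case: ifP => Pp; last by rewrite big1.
by rewrite big_mkcondr.
Qed.

End WordProducts.

(** Inclusion-exclusion. If [p] is missing from [s], toggling the membership of [p] in [T] reverses
    signs, so the sum equals its own negative; otherwise only the full set contributes. *)
Lemma signed_subset_sum (F : fieldType) (I : finType) (s : seq I) :
  [pchar F] =i pred0 ->
  \sum_(T : {set I} | all (fun p => p \in T) s) (-1) ^+ #|T|
  = (if [forall p, p \in s] then (-1) ^+ #|I| else 0) :> F.
Proof.
move=> F0; case: ifP => [/forallP sT | /forallPn[p ps]].
  rewrite (big_pred1 setT) ?cardsT // => T; apply/allP/eqP => [Ts|-> q].
    by apply/setP => q; rewrite inE Ts.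
  by rewrite inE.
pose f (T : {set I}) := if p \in T then T :\ p else p |: T.
have fK : involutive f.
  move=> T; rewrite /f; case: (boolP (p \in T)) => pT.
    by rewrite setD11 setD1K.
  by rewrite setU11 setU1K.
set S := LHS; have SN : S = - S.
  rewrite {1}/S (reindex_inj (inv_inj fK)) /S -sumrN; apply: eq_big => [T|T _].
    apply: eq_in_all => q qs; have qp : q != p by apply: contraNneq ps => <-.
    by rewrite /f; case: ifP => _; rewrite !inE ?qp ?(negPf qp).
  rewrite /f; case: (boolP (p \in T)) => pT.
    by rewrite [in RHS](cardsD1 p) pT exprS mulN1r opprK.
  by rewrite cardsU1 pT exprS mulN1r.
apply/eqP; move/eqP: SN; rewrite -addr_eq0 -mulr2n -mulr_natl mulf_eq0.
by rewrite ((pcharf0P _).1 F0).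
Qed.

Section Multilinearization.

Variables (F : fieldType) (A : lmodType F) (mul : A -> A -> A).
Hypothesis F0 : [pchar F] =i pred0.
Hypothesis mul_alg : is_assoc_algebra mul.

(** Normalising the coefficient of the identity ordering to be nonzero lets the product in that
    order be solved for in terms of the others. *)
Definition multilinear_PI d (a : seq 'I_d -> F) :=
  a (enum 'I_d) != 0 /\
  forall z : 'I_d -> A,
    \sum_(s <- permutations (enum 'I_d)) a s *: wprod mul (map z s) = 0.

(* If w is a longest word of the identity, substitute for x_i the sum of the
   z_p over those p in T with w_p = i, and take the alternating sum over all
   sets T of positions of w: only the words using every z_p, once, survive. *)
Lemma PI_multilinear : is_PI mul ->
  exists (d : nat) (a : seq 'I_d.+1 -> F), multilinear_PI a.
Proof.
case=> S0 [c [S0u /allP S0n /hasP[w0 w0S0 cw0] S0id]].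
pose S := [seq w <- S0 | c w != 0].
have w0S : w0 \in S by rewrite mem_filter cw0.
have Su : uniq S by rewrite filter_uniq.
have Sid (x : nat -> A) : \sum_(w <- S) c w *: wprod mul (map x w) = 0.
  rewrite -[RHS](S0id x) big_filter big_mkcond /=; apply: eq_bigr => w _.
  by case: eqP => //= ->; rewrite scale0r.
have [w wS wmax] : exists2 w, w \in S & forall v, v \in S -> (size v <= size w)%N.
  case: (arg_maxnP (P := xpredT) (i0 := SeqSub w0S) (fun v : seq_sub S => size (val v)))
    => // -[w wS] _ /= wmax; exists w => // v vS.
  exact: (wmax (SeqSub vS)).
have: w != [::] by apply: S0n; move: wS; rewrite mem_filter => /andP[].
case ws: (size w) => [|d]; first by rewrite -size_eq0 ws.
move=> _; exists d.
pose g (p : 'I_d.+1) := nth 0%N w p.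
have gw : map g (enum 'I_d.+1) = w.
  apply: (@eq_from_nth _ 0%N) => [|i]; rewrite size_map size_enum_ord ?ws //.
  move=> id; rewrite (nth_map ord0) ?size_enum_ord // /g.
  by rewrite nth_enum_ord.
(* The coefficient at [s] is that of the word obtained by rearranging the positions of [w] along
   [s], or zero if this word does not occur; at the identity ordering it is [c w]. *)
exists (fun s => \sum_(v <- S | v == map g s) c v); split.
  rewrite gw -big_filter (_ : [seq i <- S | i == w] = [:: w]).
    by rewrite big_seq1; move: wS; rewrite mem_filter => /andP[].
  exact: filter_pred1_uniq.
move=> z.
pose x (T : {set 'I_d.+1}) (i : nat) := \sum_(p | (p \in T) && (g p == i)) z p.
have: \sum_(T : {set 'I_d.+1}) (-1) ^+ #|T| *:
        (\sum_(v <- S) c v *: wprod mul (map (x T) v)) = 0.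
  by rewrite big1 // => T _; rewrite Sid scaler0.
have -> : \sum_(T : {set 'I_d.+1}) (-1) ^+ #|T| *:
        (\sum_(v <- S) c v *: wprod mul (map (x T) v))
  = \sum_(v <- S) c v *: \sum_(s <- words d.+1 (size v) | map g s == v)
     (if [forall p, p \in s] then (-1) ^+ d.+1 else 0) *: wprod mul (map z s).
  under eq_bigr => T _ do rewrite scaler_sumr.
  rewrite exchange_big /=; apply: eq_bigr => v _.
  under eq_bigr => T _ do rewrite scalerA mulrC -scalerA.
  rewrite -scaler_sumr; congr (_ *: _).
  have xE T : wprod mul (map (x T) v) = _ :=
    wprod_subst_sum mul_alg (fun p i => (p \in T) && (g p == i)) z v.
  transitivity (\sum_(T : {set 'I_d.+1}) \sum_(s <- words d.+1 (size v) |
      (s \in words d.+1 (size v)) && all2 (fun p i => (p \in T) && (g p == i)) s v)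
      (-1) ^+ #|T| *: wprod mul (map z s)).
    by apply: eq_bigr => T _; rewrite xE scaler_sumr big_seq_cond.
  rewrite (exchange_big_dep (fun s => (s \in words d.+1 (size v)) && (map g s == v))) /=.
    rewrite [RHS]big_seq_cond; apply: eq_bigr => s /andP[sw /eqP gs].
    have := signed_subset_sum s F0; rewrite card_ord => <-; rewrite scaler_suml.
    apply: eq_bigl => T; rewrite sw /= -gs.
    elim: (s) => //= p s' <-; rewrite eqxx andbT //.
  move=> T s _ /andP[sw]; rewrite sw /=; move: sw; rewrite mem_words.
  elim: s (v) => [|p s IHs] [|i v'] //=; rewrite !eqSS => /IHs sv.
  by case/andP=> /andP[_ /eqP ->] /sv /eqP ->.
rewrite big_seq => H.
suff: (-1) ^+ d.+1 *: \sum_(s <- permutations (enum 'I_d.+1))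
   (\sum_(v <- S | v == [seq g i | i <- s]) c v) *: wprod mul [seq z i | i <- s] = 0.
  by move/eqP; rewrite scaler_eq0 signr_eq0 => /eqP.
rewrite -[RHS]H.
rewrite (eq_bigr (fun s => \sum_(v <- S)
  if v == map g s then c v *: wprod mul (map z s) else 0)); last first.
  by move=> s _; rewrite scaler_suml big_mkcond.
rewrite exchange_big scaler_sumr big_seq; apply: eq_bigr => v vS.
rewrite -big_mkcond -scaler_sumr scalerA mulrC -scalerA; congr (_ *: _).
transitivity (\sum_(s <- words d.+1 (size v) | (map g s == v) && [forall p, p \in s])
  (-1) ^+ d.+1 *: wprod mul (map z s)); last first.
  by rewrite big_mkcondr; apply: eq_bigr => s _; case: ifP; rewrite ?scale0r.
rewrite scaler_sumr -big_filter -[RHS]big_filter.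
apply: perm_big; apply: uniq_perm; rewrite ?filter_uniq ?permutations_uniq ?words_uniq //.
move=> s; rewrite !mem_filter mem_permutations mem_words eq_sym -andbA.
case: eqP => //= gs.
have ss : size s = size v by rewrite -gs size_map.
rewrite ss eqxx andbT; apply/idP/forallP => [/perm_mem es p|sall].
  by rewrite es mem_enum.
(* A word that contains all [d.+1] positions has, by maximality of [w], length at most [d.+1]; hence
   it has no repetition. *)
apply: uniq_perm => //; last by move=> p; rewrite mem_enum sall.
  apply: (@leq_size_uniq _ (enum 'I_d.+1)); first exact: enum_uniq.
    by move=> p _; apply: sall.
  by rewrite size_enum_ord ss -ws wmax.
exact: enum_uniq.
Qed.

End Multilinearization.


(** * Latyshev's spanning set of good words *)

Fixpoint lexlt (s t : seq nat) : bool :=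
  match s, t with
  | x :: s', y :: t' => (x < y)%N || ((x == y) && lexlt s' t')
  | _, _ => false
  end.

Lemma lexlt_irr s : lexlt s s = false.
Proof. by elim: s => //= x s ->; rewrite ltnn andbF. Qed.

Lemma lexlt_trans : transitive lexlt.
Proof.
elim=> [|y t IHt] [|x s] [|z u] //=.
case/orP=> [xy|/andP[/eqP -> st]] /orP[yz|/andP[/eqP <- tu]].
- by rewrite (ltn_trans xy yz).
- by rewrite xy.
- by rewrite yz.
- by rewrite eqxx (IHt _ _ st tu) orbT.
Qed.

Lemma lexlt_cat2l s t u : lexlt (s ++ t) (s ++ u) = lexlt t u.
Proof. by elim: s => //= x s ->; rewrite ltnn eqxx. Qed.

(** Well-founded because there are finitely many permutations: the measure is the number of them
    lying lexicographically below [w]. *)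
Lemma lexlt_ind n (P : seq nat -> Prop) :
  (forall w, perm_eq w (iota 0 n) ->
    (forall v, perm_eq v (iota 0 n) -> lexlt v w -> P v) -> P w) ->
  forall w, perm_eq w (iota 0 n) -> P w.
Proof.
move=> IH w.
have [k] := ubnP (count (lexlt^~ w) (permutations (iota 0 n))).
elim: k w => // k IHk w; rewrite ltnS => wk wn; apply: (IH w wn) => v vn vw.
apply: IHk => //; apply: leq_trans wk.
have vp : v \in permutations (iota 0 n) by rewrite mem_permutations.
rewrite (seq.permP (perm_to_rem vp)) /= lexlt_irr add0n.
rewrite [leqRHS](seq.permP (perm_to_rem vp)) /= vw add1n ltnS.
by apply: sub_count => u uv; apply: lexlt_trans uv vw.
Qed.

(** At the first place where the two lists differ, the block of [vs] is one that comes later in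
    [us], so its first letter is smaller. *)
Lemma lexlt_flatten (us vs : seq (seq nat)) :
  all (predC1 [::]) us -> sorted gtn (map (head 0%N) us) ->
  perm_eq vs us -> vs != us -> lexlt (flatten vs) (flatten us).
Proof.
elim: us vs => [|u us IHus] vs.
  by move=> _ _ /perm_nilP ->.
case: vs => [|v vs]; first by move=> _ _ /perm_size.
move=> /= /andP[u0 us0] us_dec; rewrite eqseq_cons.
have us_sorted := path_sorted us_dec.
have [-> | vu] := eqVneq v u.
  by rewrite perm_cons lexlt_cat2l => vsus /= ne; apply: IHus.
move=> /perm_mem vsus _.
have vus : v \in us.
  by have := vsus v; rewrite !inE eqxx (negPf vu).
have gtn_trans : transitive gtn by move=> a b c /= ab bc; apply: ltn_trans bc ab.
have := allP (order_path_min gtn_trans us_dec) _ (map_f _ vus).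
have := allP us0 _ vus.
by case: (u) (v) u0 => [|x u'] [|y v'] //= _ _ ->.
Qed.

(** Cut [w] just before each letter of [s]. For a decreasing [s] the blocks then have decreasing
    heads, as [lexlt_flatten] requires. *)
Lemma subseq_cut (s w : seq nat) : subseq s w ->
  exists (w0 : seq nat) (us : seq (seq nat)),
    [/\ w = w0 ++ flatten us, map (head 0%N) us = s & all (predC1 [::]) us].
Proof.
elim: w s => [|x w IHw] s.
  by rewrite subseq0 => /eqP ->; exists [::], [::].
case: s => [_|y s] /=; first by exists (x :: w), [::]; rewrite cats0.
case: eqP => [<-|_] /IHw [w0 [us [-> us_s us0]]].
  by exists [::], ((y :: w0) :: us); rewrite /= us_s.
by exists (x :: w0), us.
Qed.

(* The largest size of a decreasing subsequence of [rev t] all of whose terms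
   exceed x. *)
Fixpoint ldec (t : seq nat) (x : nat) : nat :=
  if t is y :: t' then
    if (x < y)%N then maxn (ldec t' x) (ldec t' y).+1 else ldec t' x
  else 0%N.

Lemma ldec_subseq t x : exists s : seq nat,
  [/\ subseq s (rev t), sorted gtn (rcons s x) & size s = ldec t x].
Proof.
elim: t x => [|y t IHt] x /=; first by exists [::].
rewrite rev_cons -cats1.
have [s [s_t s_x s_sz]] := IHt x.
have skip : exists s, [/\ subseq s (rev t ++ [:: y]), sorted gtn (rcons s x)
   & size s = ldec t x].
  by exists s; split=> //; apply: subseq_trans s_t (prefix_subseq _ _).
case: ifP => // xy; rewrite /maxn; case: ltnP => // _.
have [r [r_t r_y r_sz]] := IHt y.
exists (rcons r y); split; last by rewrite size_rcons r_sz.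
  by rewrite cats1 -cats1 -[in X in subseq _ X]cats1 cat_subseq.
by case: r r_y {r_t r_sz} => [|z r] /=; rewrite ?xy //=
  (rcons_path _ _ (rcons r y)) last_rcons => ->; exact: xy.
Qed.

Lemma ldec_cat t1 y t2 x : (x < y)%N -> (ldec t2 y < ldec (t1 ++ y :: t2) x)%N.
Proof.
move=> xy; elim: t1 => [|z t1 IHt] /=.
  by rewrite xy leq_max ltnSn orbT.
by case: ifP => // _; rewrite leq_max IHt.
Qed.

Definition lcolor (g : seq nat) (i : nat) := ldec (rev (take i g)) (nth 0%N g i).

(** A decreasing subsequence counted at [i] can be prolonged by the letter at [i] itself.
    Consequently positions of equal colour never carry decreasing letters. *)
Lemma lcolor_lt g i j : (i < j < size g)%N -> (nth 0%N g j < nth 0%N g i)%N ->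
  (lcolor g i < lcolor g j)%N.
Proof.
case/andP=> ij jg gij; rewrite /lcolor.
have ->: take j g = take i g ++ nth 0%N g i :: drop i.+1 (take j g).
  rewrite -{1}(cat_take_drop i (take j g)) take_takel ?(ltnW ij) //.
  rewrite (drop_nth 0%N) ?nth_take // size_take jg //.
rewrite rev_cat rev_cons cat_rcons; exact: ldec_cat.
Qed.

Definition good_word d (g : seq nat) :=
  forall s, subseq s g -> sorted gtn s -> (size s < d)%N.

Lemma lcolor_bound d g i : good_word d g -> (i < size g)%N -> (lcolor g i < d)%N.
Proof.
move=> gd ig; rewrite /lcolor; have [s [s_t s_x <-]] := ldec_subseq (rev (take i g)) (nth 0%N g i).
apply: leq_ltn_trans (gd _ _ s_x); first by rewrite size_rcons leqnSn.
rewrite -(cat_take_drop i g) (drop_nth 0%N ig) -cats1 nth_cat.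
rewrite size_take ig ltnn subnn /= cat_subseq ?sub1seq ?inE ?eqxx //.
by rewrite revK in s_t.
Qed.

(* A word without long decreasing subsequences is a union of few increasing
   ones, so it is determined by the colours of its positions and letters. *)
Lemma good_words_count d n (G : seq (seq nat)) :
  uniq G -> (forall g, g \in G -> perm_eq g (iota 0 n) /\ good_word d.+1 g) ->
  (size G <= (d.+1 ^ 2) ^ n)%N.
Proof.
move=> Gu GP.
pose f (g : seq nat) : {ffun 'I_n -> 'I_d.+1} * {ffun 'I_n -> 'I_d.+1} :=
  ([ffun i : 'I_n => inord (lcolor g i)],
   [ffun v : 'I_n => inord (lcolor g (index (v : nat) g))]).
suff finj : {in G &, injective f}.
  rewrite -(size_map f) -(card_uniqP _); last by rewrite map_inj_in_uniq.
  apply: leq_trans (max_card _) _; rewrite card_prod card_ffun !card_ord.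
  by rewrite -expnMn mulnn.
move=> g h gG hG [/ffunP fp /ffunP fv].
have [gn gd] := GP _ gG; have [hn hd] := GP _ hG.
have sg : size g = n by rewrite (perm_size gn) size_iota.
have sh : size h = n by rewrite (perm_size hn) size_iota.
have ug : uniq g by rewrite (perm_uniq gn) iota_uniq.
have uh : uniq h by rewrite (perm_uniq hn) iota_uniq.
have pcol i : (i < n)%N -> lcolor g i = lcolor h i.
  move=> lin; have := fp (Ordinal lin); rewrite !ffunE /= => /(congr1 val) /=.
  by rewrite !inordK // lcolor_bound // ?sg ?sh.
have mg v : (v \in g) = (v < n)%N by rewrite (perm_mem gn) mem_iota.
have mh v : (v \in h) = (v < n)%N by rewrite (perm_mem hn) mem_iota.
have vcol v : (v < n)%N -> lcolor g (index v g) = lcolor h (index v h).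
  move=> lvn; have := fv (Ordinal lvn); rewrite !ffunE /= => /(congr1 val) /=.
  by rewrite !inordK // lcolor_bound // index_mem ?mg ?mh.
have key (g1 h1 : seq nat) i : size g1 = n -> size h1 = n -> uniq g1 -> uniq h1 ->
    g1 =i gtn n -> h1 =i gtn n ->
    (forall i, (i < n)%N -> lcolor g1 i = lcolor h1 i) ->
    (forall v, (v < n)%N -> lcolor g1 (index v g1) = lcolor h1 (index v h1)) ->
    (i < n)%N -> (forall j, (j < i)%N -> nth 0%N g1 j = nth 0%N h1 j) ->
    (nth 0%N g1 i < nth 0%N h1 i)%N -> False.
  move=> sg1 sh1 ug1 uh1 mg1 mh1 pc vc lin IH lt_gh.
  (* At the first disagreement, look for the smaller letter [v] in [h1]. Its position [j] there has
     the same colour as [i]. If [j < i], then [v] occurs twice in [g1]; if [j > i], a smaller letter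
     comes later and the colours must differ. *)
  set v := nth 0%N g1 i.
  have vg : v \in g1 by rewrite mem_nth ?sg1.
  have vn : (v < n)%N by move: vg; rewrite mg1.
  have vh : v \in h1 by rewrite mh1.
  set j := index v h1.
  have hj : nth 0%N h1 j = v by rewrite nth_index.
  have jn : (j < n)%N by rewrite -sh1 index_mem.
  have cj : lcolor h1 j = lcolor h1 i.
    by rewrite /j -vc // /v index_uniq ?sg1 // pc.
  have [ji|ij|eij] := ltngtP j i.
  - have /eqP := IH j ji; rewrite hj /v nth_uniq ?sg1 // => /eqP eji.
    by rewrite eji ltnn in ji.
  - by have := @lcolor_lt h1 i j; rewrite ij sh1 jn hj cj ltnn => /(_ isT lt_gh).
  - have : (v < nth 0%N h1 j)%N by rewrite eij.
    by rewrite hj ltnn.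
apply: (@eq_from_nth _ 0%N) => [|i]; first by rewrite sg sh.
rewrite sg; elim/ltn_ind: i => i IH lin.
have IH' j : (j < i)%N -> nth 0%N g j = nth 0%N h j.
  by move=> ji; apply: IH => //; apply: ltn_trans ji lin.
case: (ltngtP (nth 0%N g i) (nth 0%N h i)) => // lt.
  by case: (key g h i).
case: (key h g i) => // [k kn|k kn|k ki]; first by rewrite pcol.
  by rewrite vcol.
by rewrite IH'.
Qed.

Section Latyshev.

Variables (F : fieldType) (A : lmodType F) (mul : A -> A -> A).
Hypothesis mul_alg : is_assoc_algebra mul.
Variables (d : nat) (a : seq 'I_d.+1 -> F).
Hypothesis aP : multilinear_PI mul a.

(** Substitute the products of the blocks into the multilinear identity and divide by its
    coefficient at the identity ordering. *)
Lemma rearrange_blocks (us : seq (seq nat)) : size us = d.+1 -> uniq us ->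
  all (predC1 [::]) us ->
  exists b : seq (seq nat) -> F, forall u : nat -> A,
   wprod mul (map u (flatten us)) =
   \sum_(vs <- permutations us | vs != us) b vs *: wprod mul (map u (flatten vs)).
Proof.
move=> sus uus us0; case: aP => a0 az.
pose f (s : seq 'I_d.+1) := map (fun i : 'I_d.+1 => nth [::] us i) s.
pose g (vs : seq (seq nat)) := map (fun v => inord (index v us) : 'I_d.+1) vs.
have fid : f (enum 'I_d.+1) = us.
  apply: (@eq_from_nth _ [::]) => [|i]; rewrite size_map size_enum_ord ?sus //.
  by move=> lid; rewrite (nth_map ord0) ?size_enum_ord // nth_enum_ord.
have fK : cancel f g.
  move=> s; rewrite /f /g -map_comp -[RHS]map_id; apply: eq_map => i /=.
  by rewrite index_uniq ?sus // inord_val.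
have Eperm : perm_eq (map f (permutations (enum 'I_d.+1))) (permutations us).
  apply: uniq_perm; rewrite ?permutations_uniq ?map_inj_uniq ?permutations_uniq //.
    exact: can_inj fK.
  move=> vs; rewrite mem_permutations; apply/mapP/idP => [[s]|vsus].
    by rewrite mem_permutations => se ->; rewrite -fid perm_map.
  exists (g vs); last first.
    rewrite /f /g -map_comp -[LHS]map_id; apply/eq_in_map => v vvs /=.
    have vus : v \in us by rewrite -(perm_mem vsus).
    by rewrite inordK ?nth_index // -sus index_mem.
  by rewrite mem_permutations -[enum _]fK fid perm_map.
exists (fun vs => - (a (enum 'I_d.+1))^-1 * a (g vs)) => u.
pose W vs := wprod mul (map u (flatten vs)).
have := az (fun i => wprod mul (map u (nth [::] us i))).
rewrite (eq_big_seq (fun s => a (g (f s)) *: W (f s))); last first.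
  move=> s; rewrite mem_permutations => se; rewrite fK; congr (_ *: _).
  rewrite /W map_flatten (wprod_flatten mul_alg); last first.
    rewrite /f all_map all_map; apply/allP => i _ /=.
    have := allP us0 (nth [::] us i); rewrite /= => /(_ (mem_nth _ _)).
    by rewrite sus -!size_eq0 size_map; apply.
  by rewrite /f -!map_comp.
rewrite -(big_map f xpredT (fun vs => a (g vs) *: W vs)) (perm_big _ Eperm) /=.
rewrite (bigID (pred1 us)) /= -big_filter filter_pred1_uniq ?permutations_uniq //; last first.
  by rewrite mem_permutations.
rewrite big_seq1 -{1}fid fK => /eqP; rewrite addr_eq0 => /eqP E.
rewrite -/(W us) -[LHS]scale1r -(mulVf a0) -scalerA E scalerN -scaleNr scaler_sumr.
by apply: eq_bigr => vs _; rewrite scalerA.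
Qed.

Definition good_wordb d (g : seq nat) : bool :=
  all (fun m : seq bool => sorted gtn (mask m g) ==> (size (mask m g) < d)%N)
      (map val (enum {: (size g).-tuple bool})).

Lemma good_wordP k g : reflect (good_word k g) (good_wordb k g).
Proof.
apply: (iffP allP) => [gk s /subseqP[m sm ->] sd|gk m _].
  have := gk m; rewrite sd /=; apply; apply/mapP.
  by exists (@Tuple _ _ m (introT eqP sm)); rewrite ?mem_enum.
by apply/implyP; apply: gk; apply: mask_subseq.
Qed.

(** A word with a decreasing subsequence of length [d.+1] is cut at its letters; rearranging the
    blocks by the identity yields lexicographically smaller words, to which induction applies. The
    coefficients do not depend on the substitution. *)
Lemma latyshev n :
  exists2 G : seq (seq nat), (size G <= (d.+1 ^ 2) ^ n)%N &
    forall w, perm_eq w (iota 0 n) -> exists c : seq nat -> F,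
      forall u : nat -> A,
        wprod mul (map u w) = \sum_(g <- G) c g *: wprod mul (map u g).
Proof.
pose G := [seq g <- permutations (iota 0 n) | good_wordb d.+1 g].
exists G.
  apply: good_words_count; first by rewrite filter_uniq ?permutations_uniq.
  by move=> g; rewrite mem_filter mem_permutations => /andP[/good_wordP].
apply: lexlt_ind => w wn IH.
have [/good_wordP wg|] := boolP (good_wordb d.+1 w).
  exists (fun g => (g == w)%:R) => u.
  have wG : w \in G by rewrite mem_filter mem_permutations wn andbT; apply/good_wordP.
  have Gu : uniq G by rewrite filter_uniq ?permutations_uniq.
  rewrite (bigD1_seq w) //= eqxx scale1r big1 ?addr0 // => g /negPf ->.
  by rewrite scale0r.
move=> wbad.
have [s [sw s_dec ss]] : exists s, [/\ subseq s w, sorted gtn s & size s = d.+1].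
  case/allPn: wbad => m _; rewrite negb_imply -leqNgt => /andP[md ms].
  exists (take d.+1 (mask m w)); split; last by rewrite size_takel.
    exact: subseq_trans (take_subseq _ _) (mask_subseq _ _).
  exact: take_sorted.
have [w0 [us [ew us_s us0]]] := subseq_cut sw.
have sus : size us = d.+1 by rewrite -ss -us_s size_map.
have uus : uniq us.
  apply: (@map_uniq _ _ (head 0%N)); rewrite us_s; apply: (sorted_uniq (leT := gtn)) s_dec.
    by move=> x y z /= xy yz; apply: ltn_trans yz xy.
  by move=> x; rewrite /= ltnn.
have [b bE] := rearrange_blocks sus uus us0.
(* The conditions on [vs] stand below the existential, so that coefficients exist for every [vs];
   they are then collected into one function by induction on a finite list. *)
have /= red (vs : seq (seq nat)) : exists c : seq nat -> F,
  vs \in permutations us -> vs != us -> forall u : nat -> A,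
   wprod mul (map u (w0 ++ flatten vs)) = \sum_(g <- G) c g *: wprod mul (map u g).
  have [vsp|vsn] := boolP (perm_eq vs us); last first.
    by exists (fun=> 0); rewrite mem_permutations (negPf vsn).
  have [->|ne] := eqVneq vs us; first by exists (fun=> 0).
  have [||c cE] := IH (w0 ++ flatten vs); last by exists c.
    by apply: perm_trans wn; rewrite ew perm_cat2l; apply: perm_flatten.
  by rewrite ew lexlt_cat2l lexlt_flatten // us_s.
have [c cE] : exists c : seq (seq nat) -> seq nat -> F, forall vs,
   vs \in permutations us -> vs != us -> forall u : nat -> A,
   wprod mul (map u (w0 ++ flatten vs)) = \sum_(g <- G) c vs g *: wprod mul (map u g).
  have: forall r : seq (seq (seq nat)), exists c : seq (seq nat) -> seq nat -> F,
     forall vs, vs \in r -> vs \in permutations us -> vs != us -> forall u : nat -> A,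
   wprod mul (map u (w0 ++ flatten vs)) = \sum_(g <- G) c vs g *: wprod mul (map u g).
    elim=> [|v r [c cP]]; first by exists (fun _ _ => 0).
    have [cv cvP] := red v.
    exists (fun vs => if vs == v then cv else c vs) => vs; rewrite inE.
    by case: eqP => [-> _|_ /= /cP].
  by case/(_ (permutations us)) => c cP; exists c => vs vp; apply: cP.
have flat0 vs : perm_eq vs us -> flatten vs != [::].
  move=> vp; have := perm_size vp; case: vs vp => [|v vs] vp; rewrite ?sus //= => _.
  have := allP us0 v; rewrite -(perm_mem vp) mem_head => /(_ isT) /=.
  by case: v {vp}.
exists (fun g => \sum_(vs <- permutations us | vs != us) b vs * c vs g) => u.
have mapn0 vs : perm_eq vs us -> map u (flatten vs) != [::].
  by move/flat0; rewrite -!size_eq0 size_map.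
rewrite ew map_cat (wprod_cat mul_alg) ?mapn0 // bE (foldr_mul_sum mul_alg).
under [RHS]eq_bigr => g _ do rewrite scaler_suml.
rewrite exchange_big /= big_seq_cond [RHS]big_seq_cond.
apply: eq_bigr => vs /andP[vp ne].
rewrite -(wprod_cat mul_alg) ?mapn0 -?mem_permutations // -map_cat cE // scaler_sumr.
by apply: eq_bigr => g _; rewrite scalerA.
Qed.

End Latyshev.


(** * Words with a marked set of letters *)

Lemma blocks_exist (V : eqType) (X : pred V) (w : seq V) :
  exists bs : seq (seq V),
    [/\ flatten bs = w, all (predC1 [::]) bs,
        {in bs, forall b, has X b -> size b = 1%N} &
        (size bs <= 2 * count X w + 1)%N].
Proof.
(* Marked letters form blocks alone, maximal unmarked runs form the others; k marked letters
   separate at most k + 1 runs. For the induction, the extra 1 is granted only when the first block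
   is an unmarked run. *)
suff [bs [? ? ? szb]] : exists bs : seq (seq V),
    [/\ flatten bs = w, all (predC1 [::]) bs,
        {in bs, forall b, has X b -> size b = 1%N} &
        (size bs <= 2 * count X w + (if bs is b :: _ then ~~ has X b else false))%N].
  exists bs; split=> //; apply: leq_trans szb _.
  by rewrite leq_add2l; case: (bs) => // b _; case: has.
elim: w => [|x w [bs [bsw bs0 bsX szb]]]; first by exists [::].
have [xX|xX] := boolP (X x).
  exists ([:: x] :: bs); split; rewrite /= ?bsw ?xX //.
    by move=> b; rewrite inE => /predU1P[-> //|]; apply: bsX.
  have : (size bs <= 2 * count X w + 1)%N.
    by apply: leq_trans szb _; rewrite leq_add2l; case: (bs) => // b _; case: has.
  by lia.
case: bs bsw bs0 bsX szb => [|b bs] bsw bs0 bsX szb.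
  exists [:: [:: x]]; split; rewrite /= -?bsw ?(negPf xX) //=.
  by move=> b; rewrite inE => /eqP ->.
have [bX|bX] := boolP (has X b).
  exists ([:: x] :: b :: bs); split; rewrite /= -?bsw ?(negPf xX) //=.
    by move=> b'; rewrite inE => /predU1P[-> //|]; apply: bsX.
  by move: szb; rewrite -bsw bX /=; lia.
exists ((x :: b) :: bs); split; rewrite /= -?bsw ?(negPf xX) //=.
- by case/andP: bs0.
- move=> b'; rewrite inE => /predU1P[-> /=|b's].
    by rewrite (negPf xX) (negPf bX).
  by apply: bsX; rewrite inE b's orbT.
- by move: szb; rewrite -bsw bX /=; lia.
Qed.

Lemma flatten_uniqP (V : eqType) (bs : seq (seq V)) :
  all (predC1 [::]) bs -> uniq (flatten bs) ->
  uniq bs /\ {in bs &, forall b c x, x \in b -> x \in c -> b = c}.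
Proof.
elim: bs => [|b bs IHbs] //= /andP[b0 bs0]; rewrite cat_uniq => /and3P[bu /hasPn bbs ubs].
have {IHbs}[ubs' dis] := IHbs bs0 ubs.
have sep c x : c \in bs -> x \in c -> x \notin b.
  by move=> cbs xc; apply: bbs; apply/flattenP; exists c.
split.
  rewrite ubs' andbT; apply/negP => bbs'.
  by case: b b0 {bu bbs} bbs' sep => // x b _ bbs' /(_ _ x bbs'); rewrite mem_head => /(_ isT).
move=> c e; rewrite !inE => /predU1P[->|cb] /predU1P[->|eb] x xc xe //.
- by have := sep _ _ eb xe; rewrite xc.
- by have := sep _ _ cb xc; rewrite xe.
- exact: dis xc xe.
Qed.

Section EvaluationSpan.

Variables (F : fieldType) (A : lmodType F) (mul : A -> A -> A).
Hypothesis mul_alg : is_assoc_algebra mul.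
Variables (d : nat) (a : seq 'I_d.+1 -> F).
Hypothesis aP : multilinear_PI mul a.
Variables (V : eqType) (X : pred V) (w : seq V).
Hypothesis w_uniq : uniq w.

(** The map [h] fixes the unmarked blocks and permutes the marked one-letter blocks. The value of
    [h w] is thus a multilinear word in the values of the blocks, and [latyshev] applies with the
    number of blocks as degree. *)
Lemma evaluation_span :
  exists (q : nat) (phi : 'I_q -> (V -> A) -> A),
    (q <= (d.+1 ^ 2) ^ (2 * count X w + 1))%N /\
    forall h : V -> V, injective h -> (forall x, X (h x) = X x) ->
      (forall x, ~~ X x -> h x = x) -> {in w, forall x, h x \in w} ->
      exists c : 'I_q -> F, forall s : V -> A,
        wprod mul (map s (map h w)) = \sum_j c j *: phi j s.
Proof.
have [bs [bsw bs0 bsX szb]] := blocks_exist X w.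
have [bsu bs_dis] : uniq bs /\ {in bs &, forall b c x, x \in b -> x \in c -> b = c}.
  by apply: flatten_uniqP; rewrite ?bsw.
have [G szG GP] := latyshev mul_alg aP (size bs).
pose u (s : V -> A) (i : nat) := wprod mul (map s (nth [::] bs i)).
exists (size G), (fun j s => wprod mul (map (u s) (nth [::] G j))); split.
  by apply: leq_trans szG _; rewrite leq_pexp2l // expn_gt0.
move=> h hinj hX hfix hw.
have hbs b : b \in bs -> map h b \in bs.
  move=> bb; have [bX|bX] := boolP (has X b); last first.
    rewrite (_ : map h b = b) // -[RHS]map_id; apply/eq_in_map => x xb.
    by apply: hfix; apply: contra bX => xX; apply/hasP; exists x.
  have := bsX _ bb bX; case: b bb bX => // x [|//] bb /= xX _; rewrite orbF in xX.
  have xw : x \in w by rewrite -bsw; apply/flattenP; exists [:: x]; rewrite ?mem_head.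
  have := hw x xw; rewrite -bsw => /flattenP[c cb hxc].
  have cX : has X c by apply/hasP; exists (h x) => //; rewrite hX.
  have := bsX _ cb cX; case: c cb hxc {cX} => // y [|//] cb.
  by rewrite inE => /eqP -> _.
pose tau := [seq index (map h b) bs | b <- bs].
have tau_perm : perm_eq tau (iota 0 (size bs)).
  have tau_sub : {subset tau <= iota 0 (size bs)}.
    by move=> i /mapP[b bb ->]; rewrite mem_iota /= index_mem hbs.
  have tau_u : uniq tau.
    rewrite map_inj_in_uniq // => b c bb cb eqbc.
    apply: (inj_map hinj).
    by rewrite -(nth_index [::] (hbs _ bb)) eqbc nth_index ?hbs.
  apply: uniq_perm; rewrite ?iota_uniq //.
  by case: (uniq_min_size tau_u tau_sub) => //; rewrite size_iota size_map.
have [c cE] := GP _ tau_perm.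
exists (fun j => c (nth [::] G j)) => s.
transitivity (wprod mul (map (u s) tau)).
  rewrite -map_comp -bsw map_flatten (wprod_flatten mul_alg); last first.
    by rewrite all_map; apply/allP => b /(allP bs0) /=; rewrite -!size_eq0 size_map.
  congr (wprod mul _); rewrite /tau -!map_comp; apply/eq_in_map => b bb /=.
  by rewrite /u nth_index ?hbs // map_comp.
by rewrite cE (big_nth [::]) big_mkord.
Qed.

End EvaluationSpan.


(** * Young symmetrizers *)

Section YoungStabilizers.

Variables (n : nat) (X : {set 'I_n}).
Implicit Types (f row col : 'I_n -> nat) (p q g : 'S_n).

(** With [f] a row, column or antidiagonal index this is the corresponding stabilizer; the support
    condition allows working inside a part [X] of a tableau. *)
Definition fstab f : {set 'S_n} :=
  [set p : 'S_n | perm_on X p & [forall k, f (p k) == f k]].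

Lemma fstabP f p : reflect (perm_on X p /\ forall k, f (p k) = f k) (p \in fstab f).
Proof.
rewrite inE; apply: (iffP andP) => [[pX /forallP pf]|[pX pf]]; split=> //.
  by move=> k; apply/eqP.
by apply/forallP => k; rewrite pf.
Qed.

Lemma fstab1 f : 1%g \in fstab f.
Proof. by apply/fstabP; split=> [|k]; rewrite ?perm_on1 ?perm1. Qed.

Lemma fstabM f p q : p \in fstab f -> q \in fstab f -> (p * q)%g \in fstab f.
Proof.
move=> /fstabP[pX pf] /fstabP[qX qf]; apply/fstabP; split; first exact: perm_onM.
by move=> k; rewrite permM qf pf.
Qed.

Lemma fstabV f p : p \in fstab f -> (p^-1)%g \in fstab f.
Proof.
move=> /fstabP[pX pf]; apply/fstabP; split; first exact: perm_onV.
by move=> k; rewrite -[in RHS](permKV p k) pf.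
Qed.

Lemma fstab_mull f p : p \in fstab f -> forall q, ((p * q)%g \in fstab f) = (q \in fstab f).
Proof.
move=> pf q; apply/idP/idP => [pq|]; last exact: fstabM.
by rewrite -(mulKg p q); apply: fstabM pq; apply: fstabV.
Qed.

Lemma fstab_mulr f p : p \in fstab f -> forall q, ((q * p)%g \in fstab f) = (q \in fstab f).
Proof.
move=> pf q; apply/idP/idP => [qp|qf]; last exact: fstabM.
by rewrite -(mulgK p q); apply: fstabM qp _; apply: fstabV.
Qed.

Lemma fstab_tperm f i j : i \in X -> j \in X -> f i = f j -> tperm i j \in fstab f.
Proof.
move=> iX jX fij; apply/fstabP; split=> [|k]; last by case: tpermP => [->|->|].
by apply/subsetP => k; rewrite inE; case: tpermP => [->|->|_ _] //; rewrite eqxx.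
Qed.

(** The cells of [X] fill a Young diagram: no cell is taken twice, and the shape is closed under
    moving towards the corner. *)
Definition diagram row col :=
  {in X &, forall x y, row x = row y -> col x = col y -> x = y} /\
  {in X, forall x r c, (r <= row x)%N -> (c <= col x)%N ->
     exists2 y, y \in X & row y = r /\ col y = c}.

Section Dominance.

Variables (row1 row2 col2 : 'I_n -> nat) (g : 'S_n).
Hypothesis diag2 : diagram row2 col2.
Hypothesis gX : perm_on X g.
Hypothesis sep : {in X &, forall x y, row1 x = row1 y -> col2 (g x) = col2 (g y) -> x = y}.

Let M := (\max_x col2 x).+1.
Let acol k (c : 'I_M) := [set x in X | (row1 x < k)%N && (col2 (g x) == c)].
Let bcol k (c : 'I_M) := [set x in X | (row2 x < k)%N && (col2 x == c)].

Let gXE x : (g x \in X) = (x \in X).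
Proof. by have /= := perm_closed x gX. Qed.

(** If column [c] reaches row [k] or beyond, it has a cell in each earlier row, and elements of
    [acol] lie in distinct rows by [sep]. Otherwise the whole column lies in the first [k] rows and
    [g] maps [acol] into it. *)
Lemma column_count k c : (#|acol k c| <= #|bcol k c|)%N.
Proof.
have [/existsP[y /and3P[yX yc yk]]|/existsPn noy] :=
    boolP [exists y, [&& y \in X, col2 y == c :> nat & (k <= row2 y)%N]].
  have cell r : (r < k)%N -> {z | z \in X & row2 z = r /\ col2 z = c}.
    move=> rk; pose P z := [&& z \in X, row2 z == r & col2 z == c].
    have : exists z, P z.
      have [|z zX [zr zc]] := diag2.2 y yX r c _ (eq_leq (esym (eqP yc))).
        exact: leq_trans (ltnW rk) yk.
      by exists z; rewrite /P zX zr zc !eqxx.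
    by move/sigW => [z /and3P[zX /eqP zr /eqP zc]]; exists z.
  pose f x := if ltnP (row1 x) k is LtnNotGeq lt then s2val (cell _ lt) else x.
  have fP x : (row1 x < k)%N -> [/\ f x \in X, row2 (f x) = row1 x & col2 (f x) = c].
    by rewrite /f; case: ltnP => // lt _; case: (cell _ lt) => z zX [zr zc].
  rewrite -(card_in_imset (f := f)).
    apply/subset_leq_card/subsetP => _ /imsetP[x /[!inE] /and3P[xX xk xc] ->]; rewrite ?inE.
    by have [-> -> ->] := fP x xk; rewrite xk eqxx.
  move=> x y'; rewrite !inE => /and3P[xX xk /eqP xc] /and3P[yX' yk' /eqP yc'] fxy.
  have [_ rx _] := fP x xk; have [_ ry _] := fP y' yk'.
  by apply: sep => //; rewrite ?xc ?yc' // -rx -ry fxy.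
rewrite -(card_imset _ (@perm_inj _ g)).
apply/subset_leq_card/subsetP => _ /imsetP[x /[!inE] /and3P[xX xk xc] ->]; rewrite ?inE.
rewrite gXE xX xc andbT /= ltnNge; apply/negP => kg.
by have /negP := noy (g x); rewrite gXE xX xc kg.
Qed.

Let sum_columns (f r : 'I_n -> nat) k : (forall x, x \in X -> (f x < M)%N) ->
  #|[set x in X | (r x < k)%N]|
  = (\sum_(c < M) #|[set x in X | (r x < k) && (f x == c)]|)%N.
Proof.
move=> fM; rewrite -sum1_card (partition_big (fun x => inord (f x) : 'I_M) xpredT) //=.
apply: eq_bigr => c _; rewrite -sum1_card; apply: eq_bigl => x.
rewrite !inE; case xX : (x \in X) => //=; case: (_ < _)%N => //=.
by rewrite -val_eqE /= inordK ?fM.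
Qed.

Let col_lt x : (col2 x < M)%N.
Proof. by rewrite ltnS leq_bigmax. Qed.

Lemma dominance k :
  (#|[set x in X | (row1 x < k)%N]| <= #|[set x in X | (row2 x < k)%N]|)%N.
Proof.
rewrite (sum_columns (f := col2 \o g)) 1?(sum_columns (f := col2)) => [|x _|x _] //=.
by apply: leq_sum => c _; apply: column_count.
Qed.

(** The columnwise inequalities add up to an equality, so each of them is an equality. *)
Lemma dominance_eq k c :
  #|[set x in X | (row1 x < k)%N]| = #|[set x in X | (row2 x < k)%N]| ->
  #|acol k c| = #|bcol k c|.
Proof.
rewrite (sum_columns (f := col2 \o g)) 1?[RHS](sum_columns (f := col2)) => [|x _|x _] //=.
have leab (c' : 'I_M) : true ->
    (#|acol k c'| <= #|bcol k c'| ?= iff (#|acol k c'| == #|bcol k c'|))%N.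
  by move=> _; split=> //; apply: column_count.
have /leqifP := leqif_sum leab; case: ifP => [/forallP /(_ c) /eqP //|_ /ltn_eqF/eqP].
by [].
Qed.

End Dominance.

(** Send [x] to the cell in its own row and in the column of [g x]. This is a row permutation [p],
    and what remains of [g] preserves columns. *)
Lemma separating_factor row col g : diagram row col -> perm_on X g ->
  {in X &, forall x y, row x = row y -> col (g x) = col (g y) -> x = y} ->
  exists p q, [/\ p \in fstab row, q \in fstab col & g = (p * q)%g].
Proof.
move=> diag gX sep.
have gXE x : (g x \in X) = (x \in X) by have /= := perm_closed x gX.
have cell x : x \in X -> {y | y \in X & row y = row x /\ col y = col (g x)}.
  move=> xX; pose P y := [&& y \in X, row y == row x & col y == col (g x)].
  suff /sigW[y /and3P[yX /eqP yr /eqP yc]] : exists y, P y by exists y.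
  (* If that cell is missing, the column of [g x] lies entirely above the row of [x]. The equality
     case of dominance then places everything that [g] sends into this column strictly above the row
     of [x], although [x] itself is sent there. *)
  apply/existsP; apply: contraT => /existsPn noy.
  have cM : (col (g x) < (\max_x col x).+1)%N by rewrite ltnS leq_bigmax.
  have := @dominance_eq row row col g diag gX sep (row x) (Ordinal cM) erefl.
  suff -> : [set y in X | (row y < row x)%N && (col y == Ordinal cM)]
          = [set y in X | col y == col (g x)].
    rewrite -[in RHS](card_imset _ (@perm_inj _ (g^-1)%g)).
    move/eqP; rewrite -[_ == _]negbK neq_ltn proper_card //.
    rewrite properE; apply/andP; split.
      apply/subsetP => y; rewrite !inE => /and3P[yX _ yc].
      by apply/imsetP; exists (g y); rewrite ?permK // inE gXE yX.
    apply/subsetPn; exists x; last by rewrite !inE ltnn andbF.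
    by apply/imsetP; exists (g x); rewrite ?permK // inE gXE xX /=.
  apply/setP => y; rewrite !inE; case yX: (y \in X) => //=.
  case: eqP => //= yc; rewrite ?andbF ?andbT // ltnNge; apply/negP => ryx.
  have [z zX [zr zc]] := diag.2 y yX (row x) (col (g x)) ryx (eq_leq (esym yc)).
  by have /negP := noy z; rewrite /P zX zr zc !eqxx.
pose f x := if x \in X then
  odflt x [pick y in X | (row y == row x) && (col y == col (g x))] else x.
have fP x : x \in X -> [/\ f x \in X, row (f x) = row x & col (f x) = col (g x)].
  move=> xX; rewrite /f xX; case: pickP => [y /and3P[yX /eqP yr /eqP yc] //|noy].
  by have [y yX [yr yc]] := cell x xX; have := noy y; rewrite yX yr yc !eqxx.
have fN x : x \notin X -> f x = x by rewrite /f => /negPf ->.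
have finj : injective f.
  move=> x y fxy; have [xX|xX] := boolP (x \in X); have [yX|yX] := boolP (y \in X).
  - have [_ rx cx] := fP x xX; have [_ ry cy] := fP y yX.
    by apply: sep; rewrite // -?rx -?ry -?cx -?cy fxy.
  - by have [fX _ _] := fP x xX; move: fX; rewrite fxy fN // (negPf yX).
  - by have [fX _ _] := fP y yX; move: fX; rewrite -fxy fN // (negPf xX).
  - by rewrite -(fN x) // fxy fN.
pose p := perm finj.
have pX : perm_on X p.
  by apply/subsetP => x; rewrite inE permE; apply: contraR => /fN ->.
exists p, (p^-1 * g)%g; split; last by rewrite mulKVg.
  apply/fstabP; split=> // x; rewrite permE.
  by have [/fP[_ -> _]|/fN ->] := boolP (x \in X).
apply/fstabP; split; first by apply: perm_onM => //; apply: perm_onV.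
move=> y; rewrite permM -[in RHS](permKV p y) [in RHS]permE.
set x := (p^-1)%g y; have [/fP[_ _ ->] //|xX] := boolP (x \in X).
by rewrite fN // (out_perm gX).
Qed.

(** The combinatorial form of von Neumann's lemma: either two elements of one row fall into one
    column, giving a cancelling transposition, or [g] factors. *)
Lemma vnP row col g : diagram row col -> perm_on X g ->
  (exists i j, [/\ i \in X, j \in X, i != j, row i = row j & col (g i) = col (g j)])
  \/ (exists p q, [/\ p \in fstab row, q \in fstab col & g = (p * q)%g]).
Proof.
move=> diag gX.
have [/existsP[i /existsP[j /and5P[iX jX ij /eqP r /eqP c]]]|nex] :=
  boolP [exists i, exists j, 
    [&& i \in X, j \in X, i != j, row i == row j & col (g i) == col (g j)]].
  by left; exists i, j.
right; apply: separating_factor => // x y xX yX rxy cxy.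
apply: contraNeq nex => xy; apply/existsP; exists x; apply/existsP; exists y.
by rewrite xX yX xy rxy cxy !eqxx.
Qed.

End YoungStabilizers.


(** Write [B] as a product of full-rank factors. Cancelling them in the hypothesis shows that their
    product in the opposite order is the scalar matrix [c] of size the rank, and it has the same
    trace. *)
Lemma mxtrace_quasi_idempotent (F : fieldType) k (B : 'M[F]_k) (c : F) :
  B *m B = c *: B -> \tr B = c * (\rank B)%:R.
Proof.
move=> BB; pose C := row_base B *m col_base B.
have CE : C = c%:M.
  apply: (row_full_inj (col_base_full B)); apply: (row_free_inj (row_base_free B)).
  rewrite /C mulmxA mulmx_base -mulmxA mulmx_base BB.
  by rewrite mul_mx_scalar -scalemxAl mulmx_base.
have -> : \tr B = \tr (col_base B *m row_base B) by rewrite mulmx_base.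
by rewrite mxtrace_mulC -/C CE mxtrace_scalar mulr_natr.
Qed.

(** * Young symmetrizers in an arbitrary representation *)

Section YoungElements.

Variables (F : fieldType) (n : nat) (X : {set 'I_n}).
Implicit Types (row col : 'I_n -> nat) (p q g h : 'S_n).

Definition ycoef row col g : F :=
  \sum_(p in fstab X row) \sum_(q in fstab X col) (p * q == g)%g%:R * (-1) ^+ (odd_perm q).

Lemma ycoef_out row col g : ~~ perm_on X g -> ycoef row col g = 0.
Proof.
move=> gX; rewrite /ycoef big1 // => p /fstabP[pX _]; rewrite big1 // => q /fstabP[qX _].
by case: eqP => [E|]; rewrite ?mul0r //; rewrite -E perm_onM in gX.
Qed.

Section Rep.

Variables (k : nat) (rho : 'S_n -> 'M[F]_k).
Hypothesis rhoM : forall g h, rho (g * h)%g = rho g *m rho h.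

Definition rsum row := \sum_(p in fstab X row) rho p.
Definition csum col := \sum_(q in fstab X col) (-1) ^+ (odd_perm q) *: rho q.
Definition yelt row col := rsum row *m csum col.

Lemma yeltE row col : yelt row col = \sum_g ycoef row col g *: rho g.
Proof.
rewrite /yelt mulmx_suml.
under [RHS]eq_bigr => g _ do rewrite scaler_suml.
rewrite exchange_big; apply: eq_bigr => p pR.
under [RHS]eq_bigr => g _ do rewrite scaler_suml.
rewrite exchange_big mulmx_sumr; apply: eq_bigr => q qC.
rewrite (bigD1 (p * q)%g) //= big1 => [|g /negPf gne].
  by rewrite addr0 eqxx mul1r -scalemxAr rhoM.
by rewrite eq_sym gne mul0r scale0r.
Qed.

Lemma rsum_mul row p : p \in fstab X row -> rsum row *m rho p = rsum row.
Proof.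
move=> pR; rewrite /rsum mulmx_suml [RHS](reindex_inj (mulIg p)).
by apply: eq_big => q; rewrite ?fstab_mulr // rhoM.
Qed.

Lemma mul_csum col q : q \in fstab X col ->
  rho q *m csum col = (-1) ^+ (odd_perm q) *: csum col.
Proof.
move=> qC; rewrite /csum mulmx_sumr scaler_sumr [RHS](reindex_inj (mulgI q)).
apply: eq_big => p; rewrite ?fstab_mull // => pC.
by rewrite scalerA -signr_addb odd_permM addKb -scalemxAr rhoM.
Qed.

Hypothesis F0 : [pchar F] =i pred0.

Lemma opp_fixed_eq0 (V : lmodType F) (v : V) : v = - v -> v = 0.
Proof.
move/eqP; rewrite -addr_eq0 -mulr2n -scaler_nat scaler_eq0.
by rewrite ((pcharf0P _).1 F0) => /eqP.
Qed.

(** The transposition of [i] and [j] is absorbed by the row sum; moved across [g] it becomes a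
    column transposition, which the column sum turns into -1. *)
Lemma rsum_csum_eq0 row col g i j : perm_on X g ->
  i \in X -> j \in X -> i != j -> row i = row j -> col (g i) = col (g j) ->
  rsum row *m rho g *m csum col = 0.
Proof.
move=> gX iX jX ij rij cij; apply: opp_fixed_eq0.
have gXE x : (g x \in X) = (x \in X) by have /= := perm_closed x gX.
have tC : tperm (g i) (g j) \in fstab X col by rewrite fstab_tperm ?gXE.
rewrite -{1}(rsum_mul (fstab_tperm iX jX rij)) -(mulmxA (rsum row)) -rhoM.
have -> : (tperm i j * g)%g = (g * tperm (g i) (g j))%g.
  by rewrite -tpermJ mulKVg.
rewrite rhoM !mulmxA -(mulmxA _ (rho (tperm _ _))) (mul_csum tC) odd_tperm.
by rewrite (inj_eq perm_inj) ij expr1 scaleN1r mulmxN.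
Qed.

Section Diagram.

Variables (row col : 'I_n -> nat).
Hypothesis diag : diagram X row col.

Lemma fstab_TI p : p \in fstab X row -> p \in fstab X col -> p = 1%g.
Proof.
move=> /fstabP[pX pr] /fstabP[_ pc]; apply/permP => x; rewrite perm1.
have [xX|xX] := boolP (x \in X); last by rewrite (out_perm pX).
by apply: diag.1; rewrite ?pr ?pc //; have /= -> := perm_closed x pX.
Qed.

(** Row and column stabilizers intersect trivially, so the factorization is unique and a single term
    survives. *)
Lemma ycoef_mul p q : p \in fstab X row -> q \in fstab X col ->
  ycoef row col (p * q)%g = (-1) ^+ (odd_perm q).
Proof.
move=> pR qC.
have uniq_pq p' q' : p' \in fstab X row -> q' \in fstab X col ->
   (p' * q' == p * q)%g = (p' == p) && (q' == q).
  move=> pR' qC'; apply/eqP/andP => [E|[/eqP-> /eqP-> //]].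
  have E1 : (p^-1 * p' = q * q'^-1)%g.
    by apply: (mulIg q'); rewrite mulgKV -mulgA E mulKg.
  have p1 : (p^-1 * p')%g = 1%g.
    apply: fstab_TI; first by rewrite fstabM ?fstabV.
    by rewrite E1 fstabM ?fstabV.
  move: E1; rewrite p1 => E1; split.
    by rewrite -(mulKVg p p') p1 mulg1.
  by rewrite -(mulgKV q' q) -E1 mul1g.
rewrite /ycoef (bigD1 p) //= [X in _ + X]big1 ?addr0 => [|p' /andP[pR' /negPf pp]].
  rewrite (bigD1 q) //= eqxx mul1r big1 ?addr0 // => q' /andP[qC' /negPf qq].
  by rewrite uniq_pq // qq andbF mul0r.
by rewrite big1 // => q' qC'; rewrite uniq_pq // pp mul0r.
Qed.

Lemma ycoef1 : ycoef row col 1%g = 1.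
Proof. by rewrite -[1%g]mulg1 ycoef_mul ?fstab1 // odd_perm1. Qed.

(** In the first case of [vnP] both sides vanish: a factorization of [g] would put the images of [i]
    and [j] under its row part into the same cell. *)
Lemma rsum_mul_csum g : perm_on X g ->
  rsum row *m rho g *m csum col = ycoef row col g *: yelt row col.
Proof.
move=> gX; case: (vnP diag gX) => [[i [j [iX jX ij rij cij]]]|[p [q [pR qC ->]]]].
  rewrite (rsum_csum_eq0 gX iX jX) // /ycoef big1 ?scale0r // => p pR.
  rewrite big1 // => q qC; case: eqP => [E|]; last by rewrite mul0r.
  have [pX pr] := fstabP _ _ _ pR; have [_ qc] := fstabP _ _ _ qC.
  case/eqP: ij; apply: (@perm_inj _ p); apply: diag.1.
  - by have /= -> := perm_closed i pX.
  - by have /= -> := perm_closed j pX.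
  - by rewrite !pr.
  - by rewrite -qc -(qc (p j)) -!permM E.
by rewrite ycoef_mul // rhoM mulmxA rsum_mul // -mulmxA mul_csum // -scalemxAr.
Qed.

(** The scalar by which e g e is a multiple of e; it is given by coefficients alone and so is the
    same in every representation. *)
Definition yscal g : F :=
  \sum_(q in fstab X col) \sum_(p in fstab X row)
    (-1) ^+ (odd_perm q) * ycoef row col (q * g * p)%g.

Lemma yelt_mul_yelt g : perm_on X g ->
  yelt row col *m rho g *m yelt row col = yscal g *: yelt row col.
Proof.
move=> gX.
have -> : yelt row col *m rho g *m yelt row col
    = rsum row *m (csum col *m rho g *m rsum row) *m csum col.
  by rewrite /yelt !mulmxA.
have -> : csum col *m rho g *m rsum row = \sum_(q in fstab X col)
    \sum_(p in fstab X row) (-1) ^+ (odd_perm q) *: rho (q * g * p)%g.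
  rewrite !mulmx_suml; apply: eq_bigr => q _; rewrite mulmx_sumr.
  by apply: eq_bigr => p _; rewrite -!scalemxAl !rhoM.
have := rsum_mul_csum; rewrite /yscal /yelt.
move: (rsum row) (csum col) => r c key.
rewrite mulmx_sumr mulmx_suml scaler_suml; apply: eq_bigr => q qC.
rewrite mulmx_sumr mulmx_suml scaler_suml; apply: eq_bigr => p pR.
rewrite -scalemxAr -scalemxAl key ?scalerA //.
by rewrite !perm_onM //; [case: (fstabP _ _ _ qC)|case: (fstabP _ _ _ pR)].
Qed.

End Diagram.
End Rep.
End YoungElements.

(** * The regular representation and an annihilation criterion *)

Section RegularRepresentation.

Variables (F : fieldType) (n : nat).
Hypothesis F0 : [pchar F] =i pred0.
Implicit Types (g h : 'S_n).

Let rk g : 'I_(ngr n) := enum_rank g.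

Lemma regmxM g h : regmx F (g * h) = regmx F g *m regmx F h.
Proof.
apply/matrixP => i j; rewrite !mxE (bigD1 (rk (enum_val i * g)%g)) //= !mxE.
rewrite enum_rankK eqxx mul1r mulgA big1 ?addr0 // => l lne; rewrite !mxE.
case: eqP => [E|]; last by rewrite mul0r.
by rewrite E /rk enum_valK eqxx in lne.
Qed.

Lemma regmx_lin (f : 'S_n -> F) i j :
  (\sum_g f g *: regmx F g) i j = f ((enum_val i)^-1 * enum_val j)%g.
Proof.
rewrite summxE (bigD1 ((enum_val i)^-1 * enum_val j)%g) //= big1 => [|g gne].
  by rewrite !mxE mulKVg eqxx mulr1 addr0.
rewrite !mxE; case: eqP => [E|]; last by rewrite mulr0.
by rewrite -E mulKg eqxx in gne.
Qed.

Lemma regmx1 : regmx F (1 : 'S_n) = 1%:M.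
Proof. by apply/matrixP => i j; rewrite !mxE mulg1 (inj_eq enum_val_inj). Qed.

Lemma mxtrace_regmx_lin (f : 'S_n -> F) :
  \tr (\sum_g f g *: regmx F g) = (ngr n)%:R * f 1%g.
Proof.
rewrite /mxtrace; under eq_bigr => i _ do rewrite regmx_lin mulVg.
by rewrite sumr_const card_ord mulr_natl.
Qed.

Lemma ngr_neq0 : (ngr n)%:R != 0 :> F.
Proof.
rewrite ((pcharf0P _).1 F0) -lt0n; apply/card_gt0P; by exists 1%g.
Qed.

(** Otherwise h^-1 M, with M the given element, would have square zero, hence trace zero; but its
    trace is n! times [f h]. *)
Lemma regmx_semiprime (f : 'S_n -> F) h : f h != 0 ->
  (\sum_g f g *: regmx F g) *m regmx F h^-1 *m (\sum_g f g *: regmx F g) != 0.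
Proof.
set M := \sum_g _ => fh; apply: contraNneq fh => M0.
pose B := regmx F h^-1 *m M.
have BB : B *m B = 0 *: B.
  by rewrite scale0r /B -!mulmxA [M *m _]mulmxA M0 mulmx0.
have /eqP := mxtrace_quasi_idempotent BB.
have -> : B = \sum_g f (h * g)%g *: regmx F g.
  rewrite /B /M mulmx_sumr (reindex_inj (mulgI h)); apply: eq_bigr => g _.
  by rewrite -scalemxAr -regmxM mulKg.
by rewrite mxtrace_regmx_lin mulg1 mul0r mulf_eq0 (negPf ngr_neq0).
Qed.

Section Annihilation.

Variables (X : {set 'I_n}) (row col : 'I_n -> nat).
Hypothesis diag : diagram X row col.
Variables (A : lmodType F) (S : Type) (Phi : 'S_n -> S -> A) (sact : 'S_n -> S -> S).
Hypothesis PhiM : forall g h s, Phi (g * h)%g s = Phi g (sact h s).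
Variables (q : nat) (phi : 'I_q -> S -> A) (D : {set 'S_n}).
Hypothesis Phi_span : forall g, perm_on X g ->
  exists c : 'I_q -> F, forall s, Phi g s = \sum_j c j *: phi j s.
Hypothesis DX : forall g, g \in D -> perm_on X g.
Hypothesis D_ycoef : {in D &, forall g h,
  ycoef F X row col (g * h^-1)%g = (g == h)%:R}.
Hypothesis qD : (q < #|D|)%N.

(* The right ideal e F[Sym X] has dimension at least #|D| > q, so some nonzero
   e y annihilates Phi; multiplying it back into e, e itself does. *)
Lemma young_annihilates s : \sum_g ycoef F X row col g *: Phi g s = 0.
Proof.
have [B BE] : exists B : 'S_n -> 'I_q -> F, forall g, perm_on X g ->
    forall s, Phi g s = \sum_j B g j *: phi j s.
  apply: (@fin_all_exists _ _ (fun g c =>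
    perm_on X g -> forall s, Phi g s = \sum_j c j *: phi j s)).
  move=> g; have [gX|gX] := boolP (perm_on X g); last by exists (fun=> 0).
  by have [c cP] := Phi_span gX; exists c.
pose e := ycoef F X row col.
(* Row [i] holds the coordinates, on the [phi j], of the action of the translate of [e] by the
   [i]-th element of [D]. There are more rows than columns, so some combination [y] of translates
   annihilates [Phi]; [x] lists its coefficients. *)
pose Mat : 'M[F]_(#|D|, q) :=
  \matrix_(i, j) \sum_g e (g * (enum_val i)^-1)%g * B g j.
have : kermx Mat != 0.
  rewrite kermx_eq0 /row_free neq_ltn; apply/orP; left.
  exact: leq_ltn_trans (rank_leq_col _) qD.
case/rowV0Pn => y /sub_kermxP yM y0.
pose x g := \sum_i y 0 i * e (g * (enum_val i)^-1)%g.
(* On [D] the coefficients of the combination are those of [y], so the combination is nonzero in the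
   group algebra. *)
have xD i : x (enum_val i) = y 0 i.
  rewrite /x (bigD1 i) //= /e D_ycoef ?enum_valP // eqxx mulr1 big1 ?addr0 // => j ji.
  by rewrite D_ycoef ?enum_valP // (inj_eq enum_val_inj) eq_sym (negPf ji) mulr0.
have [i yi] : exists i, y 0 i != 0.
  apply/existsP; apply: contraNT y0 => /existsPn y0; apply/eqP/rowP => i.
  by rewrite mxE; apply/eqP; have := y0 i; rewrite negbK.
set h := enum_val i; have hX : perm_on X h := DX (enum_valP i).
have eX g : ~~ perm_on X g -> e g = 0 by apply: ycoef_out.
have Phix s' : \sum_g x g *: Phi g s' = 0.
  have xX g : ~~ perm_on X g -> x g = 0.
    move=> gX; rewrite /x big1 // => j _; rewrite eX ?mulr0 //.
    apply: contra gX => gX; rewrite -(mulgKV (enum_val j) g) perm_onM //.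
    exact: DX (enum_valP j).
  transitivity (\sum_j (y *m Mat) 0 j *: phi j s'); last first.
    by rewrite yM big1 // => j _; rewrite mxE scale0r.
  transitivity (\sum_g \sum_j (x g * B g j) *: phi j s').
    apply: eq_bigr => g _; have [gX|gX] := boolP (perm_on X g).
      by rewrite BE // scaler_sumr; apply: eq_bigr => j _; rewrite scalerA.
    by rewrite xX // scale0r big1 // => j _; rewrite mul0r scale0r.
  rewrite exchange_big; apply: eq_bigr => j _; rewrite -scaler_suml; congr (_ *: _).
  rewrite mxE; under [RHS]eq_bigr => l _ do rewrite mxE mulr_sumr.
  rewrite exchange_big; apply: eq_bigr => g _; rewrite mulr_suml.
  by apply: eq_bigr => l _; rewrite mulrA.
(* A group algebra element is recovered from the identity row of its regular matrix; right
   multiplication of it becomes a change of [s'], whence the annihilator of [Phi] is a right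
   ideal. *)
pose Psi s' (M : 'M[F]_(ngr n)) := \sum_g M (rk 1%g) (rk g) *: Phi g s'.
have Psi_lin f s' : Psi s' (\sum_g f g *: regmx F g) = \sum_g f g *: Phi g s'.
  by apply: eq_bigr => g _; rewrite regmx_lin !enum_rankK invg1 mul1g.
have Psi_reg s' M g : Psi s' (M *m regmx F g) = Psi (sact g s') M.
  rewrite /Psi (reindex_inj (mulIg g)); apply: eq_bigr => l _; rewrite PhiM; congr (_ *: _).
  rewrite mxE (bigD1 (rk l)) //= mxE !enum_rankK eqxx mulr1 big1 ?addr0 // => m mne.
  rewrite mxE enum_rankK; case: eqP => [/mulIg E|]; last by rewrite mulr0.
  by rewrite -E /rk enum_valK eqxx in mne.
have Psi_sum s' I (r : seq I) (f : I -> F) M :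
    Psi s' (\sum_(i <- r) f i *: M i) = \sum_(i <- r) f i *: Psi s' (M i).
  rewrite /Psi; under eq_bigr => g _ do rewrite summxE scaler_suml.
  rewrite exchange_big; apply: eq_bigr => l _; rewrite scaler_sumr.
  by apply: eq_bigr => g _; rewrite mxE scalerA.
pose E := yelt X (@regmx F n) row col.
have EE : E = \sum_g e g *: regmx F g by apply: yeltE regmxM _ _.
pose Y := \sum_j y 0 j *: regmx F (enum_val j).
have EY : E *m Y = \sum_g x g *: regmx F g.
  rewrite /Y mulmx_sumr; under [RHS]eq_bigr => g _ do rewrite scaler_suml.
  rewrite exchange_big; apply: eq_bigr => j _.
  rewrite -scalemxAr EE mulmx_suml scaler_sumr [RHS](reindex_inj (mulIg (enum_val j))).
  by apply: eq_bigr => g _; rewrite -scalemxAl -regmxM scalerA mulgK.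
pose c := \sum_j y 0 j * yscal F X row col (enum_val j * h^-1)%g.
have cE : E *m Y *m regmx F h^-1 *m E = c *: E.
  rewrite /Y mulmx_sumr !mulmx_suml scaler_suml; apply: eq_bigr => j _.
  rewrite -scalemxAr -!scalemxAl -(mulmxA E) -regmxM.
  rewrite (yelt_mul_yelt regmxM F0 diag) ?scalerA //.
  by rewrite perm_onM ?perm_onV // DX ?enum_valP.
(* If [c] were zero, multiplying [cE] by [Y] would make the product in [regmx_semiprime] vanish for
   the nonzero element [x]. *)
have c0 : c != 0.
  have := @regmx_semiprime x h; rewrite xD yi -EY => /(_ isT).
  by apply: contraNneq => c0; rewrite mulmxA cE c0 scale0r mul0mx.
suff: c *: \sum_g ycoef F X row col g *: Phi g s = 0.
  by move/eqP; rewrite scaler_eq0 (negPf c0) => /eqP.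
rewrite -Psi_lin -EE.
have -> : c *: Psi s E = Psi s (c *: E).
  move: E {EE EY cE} => E; rewrite /Psi scaler_sumr.
  by apply: eq_bigr => g _; rewrite mxE scalerA.
rewrite -cE {2}EE mulmx_sumr; under eq_bigr => g _ do rewrite -scalemxAr.
rewrite Psi_sum big1 // => g _; rewrite !Psi_reg EY Psi_lin.
by rewrite Phix scaler0.
Qed.

End Annihilation.
End RegularRepresentation.


(** * Many independent translates: antidiagonals *)

Lemma exp_lt_fact c : exists2 b, (0 < b)%N & (c ^ b < b`!)%N.
Proof.
have fact_ge m j : (m ^ j <= (m + j)`!)%N.
  elim: j => [|j IHj]; first by rewrite expn0 fact_gt0.
  by rewrite addnS factS expnS leq_mul // ltnW // ltnS leq_addr.
(* With b = 2m the power of c is (c^2)^m, which is below m^m, and m^m is at most (2m)!. *)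
pose m := (c ^ 2).+1; exists (m + m)%N; first by rewrite addnS.
apply: leq_trans (fact_ge m m).
by rewrite addnn -muln2 mulnC expnM ltn_exp2r.
Qed.

Lemma perm_onT (T : finType) (p : {perm T}) : perm_on setT p.
Proof. by apply/subsetP => x _; rewrite inE. Qed.

Section Antidiagonals.

Variables (n : nat) (X : {set 'I_n}).

(** Permute each of [m] fibres of size at least [b] independently. Fibres are added one at a time,
    and disjointness of the supports makes multiplication injective. *)
Lemma fstab_card_ge (f : 'I_n -> nat) lo b m :
  (forall t, (t < m)%N -> (b <= #|[set x in X | f x == (lo + t)%N]|)%N) ->
  (b`! ^ m <= #|fstab X f|)%N.
Proof.
move=> big_fibre.
pose Y t := [set x in X | (lo <= f x < lo + t)%N].
suff H t : (t <= m)%N -> (b`! ^ t <= #|fstab (Y t) f|)%N.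
  apply: leq_trans (H m (leqnn m)) _; apply/subset_leq_card/subsetP => p.
  move=> /fstabP[pY pf]; apply/fstabP; split=> //; apply: subset_trans pY _.
  by apply/subsetP => x; rewrite inE => /andP[].
elim: t => [|t IHt] tm.
  by apply/card_gt0P; exists 1%g; apply: fstab1.
pose Z := [set x in X | f x == (lo + t)%N].
pose P : {set 'S_n} := [set p | perm_on Z p].
have cP : (b`! <= #|P|)%N.
  by rewrite cardsE card_perm leq_fact // big_fibre.
rewrite expnSr; apply: leq_trans (leq_mul (IHt (ltnW tm)) cP) _.
rewrite -cardsX -(card_in_imset (f := fun u : 'S_n * 'S_n => (u.1 * u.2)%g)).
  apply/subset_leq_card/subsetP => _ /imsetP[[p q] /setXP[/= /fstabP[pY pf] qZ] ->].
  rewrite inE in qZ.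
  apply/fstabP; split.
    apply: perm_onM; [apply: subset_trans pY _|apply: subset_trans qZ _];
      apply/subsetP => x; rewrite !inE => /andP[-> /=].
      by case/andP=> -> xt; rewrite addnS ltnS ltnW.
    by move/eqP->; rewrite leq_addr addnS ltnSn.
  move=> x; rewrite permM -[RHS]pf; have [yZ|yZ] := boolP (p x \in Z).
    have : q (p x) \in Z by have /= -> := perm_closed (p x) qZ.
    by move: yZ; rewrite !inE => /andP[_ /eqP ->] /andP[_ /eqP ->].
  by rewrite (out_perm qZ).
move=> [p q] [p' q'] /setXP[/= /fstabP[pY _] qZ] /setXP[/= /fstabP[pY' _] qZ'] E.
rewrite !inE in qZ qZ'.
have E1 : (p'^-1 * p = q' * q^-1)%g.
  by apply: (mulIg q); rewrite mulgKV -mulgA E mulKg.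
have p1 : (p'^-1 * p)%g = 1%g.
  apply/permP => x; rewrite perm1; have [xY|xY] := boolP (x \in Y t).
    rewrite E1 (@out_perm _ Z) //; first by rewrite perm_onM ?perm_onV.
    by move: xY; rewrite !inE => /and3P[-> _]; rewrite ltn_neqAle => /andP[].
  by rewrite (@out_perm _ (Y t)) ?perm_onM ?perm_onV.
have pp : p = p' by apply/esym/eqP; rewrite -(mulKVg p' p) p1 mulg1.
by move: E; rewrite pp => /mulgI ->.
Qed.

Variables (row col : 'I_n -> nat).
Hypothesis diag : diagram X row col.
Let antidiag k := (row k + col k)%N.

(** Induction on the antidiagonal, then on the row. The permutation [p] cannot move [x] to an
    earlier column, as it would land on a shorter antidiagonal, already fixed. Hence [q (p x)] lies
    in a row not below that of [x], and a strictly higher one is excluded by the inner induction. *)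
Lemma antidiag_TI p q : p \in fstab X row -> q \in fstab X col ->
  (p * q)%g \in fstab X antidiag -> (p * q)%g = 1%g.
Proof.
move=> /fstabP[pX pr] /fstabP[qX qc] /fstabP[pqX pqf].
have pXE x : (p x \in X) = (x \in X) by have /= := perm_closed x pX.
have qXE x : (q x \in X) = (x \in X) by have /= := perm_closed x qX.
suff fixX s r x : x \in X -> antidiag x = s -> row x = r -> p x = x /\ q x = x.
  apply/permP => x; rewrite perm1 permM; have [xX|xX] := boolP (x \in X).
    by have [-> ->] := fixX _ _ x xX erefl erefl.
  by rewrite (out_perm pX xX) (out_perm qX xX).
elim/ltn_ind: s r x => s IHs; elim/ltn_ind => r IHr x xX xs xr.
have col_ge : (col x <= col (p x))%N.
  rewrite leqNgt; apply/negP => lt.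
  have ls : (antidiag (p x) < s)%N by rewrite -xs /antidiag pr ltn_add2l.
  have [/perm_inj E _] := IHs _ ls _ (p x) (etrans (pXE x) xX) erefl erefl.
  by rewrite E ltnn in lt.
set z := q (p x).
have zX : z \in X by rewrite qXE pXE.
have zs : antidiag z = s by rewrite /z -permM pqf.
have zc : col z = col (p x) by rewrite /z qc.
have rz : row z = row x.
  apply/eqP; rewrite eqn_leq; apply/andP; split.
    by move: zs xs; rewrite /antidiag zc; lia.
  rewrite leqNgt; apply/negP => lt; rewrite xr in lt.
  have [pz qz] := IHr _ lt z zX zs erefl.
  have zx : z = x by apply: (@perm_inj _ p); apply: (@perm_inj _ q); rewrite pz qz.
  by rewrite zx xr ltnn in lt.
have pxx : p x = x.
  apply: diag.1; rewrite ?pXE ?pr // -zc.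
  by move: zs xs; rewrite /antidiag rz; lia.
by split=> //; rewrite -{1}pxx; apply: diag.1; rewrite // zc pxx.
Qed.

(** The translates of the symmetrizer by antidiagonal permutations thus have an identity matrix of
    coefficients at these permutations, which gives their independence. *)
Lemma antidiag_ycoef (F : fieldType) : {in fstab X antidiag &, forall g h,
  ycoef F X row col (g * h^-1)%g = (g == h)%:R}.
Proof.
move=> g h gD hD; have [->|gh] := eqVneq g h; first by rewrite mulgV ycoef1.
rewrite /ycoef big1 // => p pR; rewrite big1 // => q qC.
case: eqP => [E|]; last by rewrite mul0r.
have ghD : (g * h^-1)%g \in fstab X antidiag by rewrite fstabM ?fstabV.
have := antidiag_TI pR qC; rewrite E => /(_ ghD) E1.
by rewrite -(mulgKV h g) E1 mul1g eqxx in gh.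
Qed.

End Antidiagonals.

(** * The canonical tableau and its corner rectangle *)

Section BoxPositions.

Variable la : seq nat.

Lemma box_pos_inj : injective (box_pos la).
Proof.
elim: la => [|a l IHl] x y /=; first by case.
case: ltnP => xa; case: ltnP => ya //=; first by case.
case; case: (box_pos l _) (@IHl (x - a)%N (y - a)%N) => r c.
case: (box_pos l _) => r' c' /= IH er ec; rewrite -(subnK xa) -(subnK ya).
by rewrite IH // er ec.
Qed.

Lemma box_pos_lt x : (x < sumn la)%N ->
  ((box_pos la x).2 < nth 0%N la (box_pos la x).1)%N.
Proof.
elim: la x => [|a l IHl] x //= xa; case: (ltnP x a) => //= ax.
by apply: IHl; rewrite ltn_subLR.
Qed.

Lemma box_pos_surj r c : (c < nth 0%N la r)%N ->
  exists2 x, (x < sumn la)%N & box_pos la x = (r, c).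
Proof.
elim: la r => [|a l IHl] [|r] //= ca; rewrite ?nth_nil //.
  by exists c; rewrite ?ca // (leq_trans ca) ?leq_addr.
have [x xl E] := IHl r ca; exists (a + x)%N; first by rewrite ltn_add2l.
by rewrite ltnNge leq_addr /= addKn E.
Qed.

End BoxPositions.

Section CanonicalTableau.

Variables (n : nat) (la : seq nat).
Hypothesis la_part : is_partition n la.

Definition trow (k : 'I_n) := (box_pos la k).1.
Definition tcol (k : 'I_n) := (box_pos la k).2.

Lemma part_nth_leq i j : (i <= j)%N -> (nth 0%N la j <= nth 0%N la i)%N.
Proof.
case/and3P: la_part => srt _ _ ij.
have [jl|lj] := ltnP j (size la); last by rewrite nth_default.
apply: (sorted_leq_nth (leT := fun a b : nat => (b <= a)%N)) => //.
- by move=> x y z /= xy yz; apply: leq_trans yz xy.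
- by rewrite inE (leq_ltn_trans ij).
Qed.

Lemma tcell_inj k l : trow k = trow l -> tcol k = tcol l -> k = l.
Proof.
rewrite /trow /tcol => r c; apply: val_inj; apply: (@box_pos_inj la) => /=.
by move: r c; case: box_pos => ? ?; case: box_pos => ? ? /= -> ->.
Qed.

Lemma tcell_lt k : (tcol k < nth 0%N la (trow k))%N.
Proof. by apply: box_pos_lt; case/and3P: la_part => _ _ /eqP ->. Qed.

Lemma tcell_exists r c : (c < nth 0%N la r)%N -> exists k, trow k = r /\ tcol k = c.
Proof.
move=> /box_pos_surj[x]; case/and3P: la_part => _ _ /eqP -> xn E.
by exists (Ordinal xn); rewrite /trow /tcol /= E.
Qed.

Lemma tableau_diagram (X : {set 'I_n}) :
  (forall k l, k \in X -> (trow l <= trow k)%N -> (tcol l <= tcol k)%N -> l \in X) ->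
  diagram X trow tcol.
Proof.
move=> Xdown; split=> [k l _ _|k kX r c rk ck]; first exact: tcell_inj.
have [|l [lr lc]] := @tcell_exists r c.
  by apply: leq_ltn_trans ck (leq_trans (tcell_lt k) (part_nth_leq rk)).
by exists l => //; apply: Xdown kX _ _; rewrite ?lr ?lc.
Qed.

Lemma row_stabE : row_stab n la = fstab setT trow.
Proof. by apply/setP => p; rewrite [RHS]inE perm_onT inE. Qed.

Lemma col_stabE : col_stab n la = fstab setT tcol.
Proof. by apply/setP => p; rewrite [RHS]inE perm_onT inE. Qed.

(** The width 2b lets b consecutive antidiagonals cross all b rows, giving (b!)^b antidiagonal
    permutations on O(b^2) cells. *)
Definition rect b : {set 'I_n} := [set k | (trow k < b)%N && (tcol k < 2 * b)%N].

Lemma rect_diagram b : diagram (rect b) trow tcol.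
Proof.
apply: tableau_diagram => k l; rewrite !inE => /andP[kr kc] lr lc.
by rewrite (leq_ltn_trans lr kr) (leq_ltn_trans lc kc).
Qed.

Lemma rect_card b : (#|rect b| <= b * (2 * b))%N.
Proof.
case: b => [|b'].
  rewrite leqn0 cards_eq0; apply/eqP/setP => k; by rewrite !inE.
pose f (k : 'I_n) : 'I_b'.+1 * 'I_(2 * b'.+1) := (inord (trow k), inord (tcol k)).
have /card_in_imset <- : {in [set k | (trow k < b'.+1)%N && (tcol k < 2 * b'.+1)%N] &, injective f}.
  move=> k l; rewrite !inE => /andP[kr kc] /andP[lr lc] [/(congr1 val) /= r /(congr1 val) /= c].
  by apply: tcell_inj; [rewrite !inordK in r|rewrite !inordK in c].
by apply: leq_trans (max_card _) _; rewrite card_prod !card_ord.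
Qed.

Lemma rect_antidiag_card b : (2 * b <= nth 0%N la b)%N ->
  (b`! ^ b <= #|fstab (rect b) (fun k => trow k + tcol k)%N|)%N.
Proof.
move=> la_big.
(* The antidiagonals used have indices b - 1 + t with t < b; each meets every row i < b, in column b
   - 1 + t - i < 2b. *)
apply: (@fstab_card_ge _ _ _ b.-1) => t tb.
have cell (i : 'I_b) : exists k, trow k = i /\ tcol k = (b.-1 + t - i)%N.
  apply: tcell_exists; apply: leq_trans (part_nth_leq (ltnW (ltn_ord i))).
  by apply: leq_trans la_big; have := ltn_ord i; lia.
have [f fE] := fin_all_exists cell.
have finj : injective f.
  by move=> i j E; apply: val_inj; rewrite /= -(proj1 (fE i)) -(proj1 (fE j)) E.
rewrite -[leqLHS](card_ord b) -cardsT -(card_imset _ finj).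
apply/subset_leq_card/subsetP => _ /imsetP[i _ ->]; rewrite !inE.
have [-> ->] := fE i; have := ltn_ord i; lia.
Qed.

End CanonicalTableau.

Section SubTableau.

Variables (F : fieldType) (n : nat) (X : {set 'I_n}) (row col : 'I_n -> nat).
Hypothesis F0 : [pchar F] =i pred0.
Variables (k : nat) (rho : 'S_n -> 'M[F]_k).
Hypothesis rhoM : forall g h, rho (g * h)%g = rho g *m rho h.

(** Row and column sums over the full tableau absorb those over [X] up to the orders of the smaller
    stabilizers, which are invertible in characteristic zero. So the full symmetrizer is a multiple
    of a product containing the small one. *)
Lemma yelt_sub_eq0 : yelt X rho row col = 0 -> yelt setT rho row col = 0.
Proof.
move=> E0.
have sub f : {subset fstab X f <= fstab setT f}.
  by move=> p /fstabP[_ pf]; apply/fstabP; rewrite perm_onT.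
have cn0 f : #|fstab X f|%:R != 0 :> F.
  by rewrite ((pcharf0P _).1 F0) -lt0n; apply/card_gt0P; exists 1%g; apply: fstab1.
have RR : rsum setT rho row *m rsum X rho row = #|fstab X row|%:R *: rsum setT rho row.
  rewrite {2}/rsum mulmx_sumr (eq_bigr (fun=> rsum setT rho row)) => [|p pX].
    by rewrite sumr_const scaler_nat.
  by rewrite rsum_mul ?sub.
have CC : csum X rho col *m csum setT rho col = #|fstab X col|%:R *: csum setT rho col.
  rewrite {1}/csum mulmx_suml (eq_bigr (fun=> csum setT rho col)) => [|q qX].
    by rewrite sumr_const scaler_nat.
  by rewrite -scalemxAl mul_csum ?sub // scalerA -expr2 sqrr_sign scale1r.
have: rsum setT rho row *m yelt X rho row col *m csum setT rho col = 0.
  by rewrite E0 mulmx0 mul0mx.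
rewrite /yelt mulmxA RR -mulmxA CC -scalemxAl -scalemxAr => /eqP.
by rewrite !scaler_eq0 !(negPf (cn0 _)) => /eqP.
Qed.

End SubTableau.


Section WordAnnihilation.

Variables (F : fieldType) (A : lmodType F) (mul : A -> A -> A).
Hypothesis F0 : [pchar F] =i pred0.
Hypothesis mul_alg : is_assoc_algebra mul.
Variables (d : nat) (a : seq 'I_d.+1 -> F).
Hypothesis aP : multilinear_PI mul a.
Variable b : nat.
Hypothesis b_gt0 : (0 < b)%N.
Hypothesis b_big : (((d.+1 ^ 2) ^ 5) ^ b < b`!)%N.
Variables (V : finType) (n : nat) (i0 : 'I_n -> V) (act : 'S_n -> V -> V).
Hypothesis i0_inj : injective i0.
Hypothesis act_i0 : forall g k, act g (i0 k) = i0 (g k).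
Hypothesis act_out : forall g v, (forall k, v != i0 k) -> act g v = v.
Variable w : seq V.
Hypothesis w_uniq : uniq w.
Hypothesis w_all : forall v, v \in w.
Variable la : seq nat.
Hypothesis la_part : is_partition n la.
Hypothesis la_big : (2 * b <= nth 0%N la b)%N.

Lemma i0_caseP v : (exists k, v = i0 k) \/ (forall k, v != i0 k).
Proof.
have [/existsP[k /eqP]|/existsPn] := boolP [exists k, v == i0 k]; last by right.
by left; exists k.
Qed.

Lemma actM g h v : act (g * h)%g v = act h (act g v).
Proof.
by case: (i0_caseP v) => [[k ->]|vn]; rewrite ?act_i0 ?permM // !act_out.
Qed.

Lemma act1 v : act 1%g v = v.
Proof. by case: (i0_caseP v) => [[k ->]|vn]; rewrite ?act_i0 ?perm1 // !act_out. Qed.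

Lemma rect_word_annihilates (s : V -> A) :
  \sum_g ycoef F (rect n la b) (trow la) (tcol la) g
     *: wprod mul (map s (map (act g) w)) = 0.
Proof.
set X := rect n la b.
pose XV v := [exists k in X, v == i0 k].
have XVP k : XV (i0 k) = (k \in X).
  apply/exists_inP/idP => [[l lX /eqP/i0_inj -> //]|kX]; by exists k.
have [q [phi [q_le span]]] := evaluation_span mul_alg aP XV w_uniq.
(* Here [Phi g] evaluates the word [g w], and right multiplication by [h] becomes precomposition of
   the substitution with [act h]. *)
apply: (@young_annihilates F n F0 X _ _ (rect_diagram la_part b) A (V -> A)
  (fun g s => wprod mul (map s (map (act g) w))) (fun h s => s \o act h) _ q phi
  (fstab X (fun k => trow la k + tcol la k)%N)).
- move=> g h s'; congr (wprod mul _); rewrite -!map_comp.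
  by apply: eq_map => v /=; rewrite actM.
- move=> g gX; apply: span => [v v'|v|v|v _] //.
  + move/(congr1 (act g^-1)%g); by rewrite -!actM mulgV !act1.
  + case: (i0_caseP v) => [[k ->]|vn]; last by rewrite act_out.
    by rewrite act_i0 !XVP; have /= -> := perm_closed k gX.
  + case: (i0_caseP v) => [[k ->]|vn]; last by rewrite act_out.
    by rewrite XVP act_i0 => kX; rewrite (out_perm gX).
- by move=> g /fstabP[].
- exact: antidiag_ycoef (rect_diagram la_part b) F.
apply: leq_trans (rect_antidiag_card la_part la_big).
apply: leq_ltn_trans q_le _.
have cX : (count XV w <= b * (2 * b))%N.
  apply: leq_trans (rect_card n la b).
  rewrite -size_filter -(card_imset _ i0_inj) cardE.
  apply: uniq_leq_size; first by rewrite filter_uniq.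
  move=> v; rewrite mem_filter mem_enum => /andP[/exists_inP[k kX /eqP ->] _].
  exact: imset_f.
(* At most 2 b^2 letters are marked, so the degree is at most 4 b^2 + 1, hence at most 5 b^2; this
   is the origin of the exponent 5 in [b_big]. *)
apply: leq_ltn_trans (_ : _ <= ((d.+1 ^ 2) ^ 5) ^ (b * b))%N _.
  rewrite -[in leqRHS]expnM leq_pexp2l ?expn_gt0 //; nia.
by rewrite expnM ltn_exp2r.
Qed.

End WordAnnihilation.


(** * Cycle types *)

Section CycleType.

Variable T : finType.
Implicit Types g h : {perm T}.

Lemma eq_iter_porbit g x i j :
  (iter i g x == iter j g x) = (i == j %[mod #|porbit g x|]).
Proof.
set m := #|porbit g x|.
have m_gt0 : (0 < m)%N by rewrite lt0n card_porbit_neq0.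
have modE l : iter l g x = iter (l %% m) g x.
  rewrite {1}(divn_eq l m) addnC iterD; congr (iter _ _ _).
  by elim: (l %/ m)%N => // k IHk; rewrite mulSn iterD IHk iter_porbit.
rewrite modE (modE j) -(nth_traject g (ltn_pmod i m_gt0)) -(nth_traject g (ltn_pmod j m_gt0)).
by rewrite nth_uniq ?size_traject ?ltn_pmod // uniq_traject_porbit.
Qed.

(** Match the orbits of [g] with orbits of [h] of equal size, choose a representative in each, and
    send the i-th iterate of one representative to the i-th iterate of the other. *)
Lemma perm_eq_card_porbits_conj g h :
  perm_eq (map (fun O : {set T} => #|O|) (enum (porbits g)))
          (map (fun O : {set T} => #|O|) (enum (porbits h))) ->
  exists x, h = (g ^ x)%g.
Proof.
set sg := enum (porbits g); set sh := enum (porbits h) => /(perm_iotaP 0%N)[Is Isp Eg].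
have [x0 _|T0] := pickP T; last by exists 1%g; apply/permP => x; have := T0 x.
rewrite size_map in Isp.
have sIs : size Is = size sg by move/(congr1 size): Eg; rewrite !size_map.
pose phi O := nth set0 sh (nth 0%N Is (index O sg)).
have Is_lt O : O \in sg -> (nth 0%N Is (index O sg) < size sh)%N.
  move=> Og; have : nth 0%N Is (index O sg) \in Is by rewrite mem_nth // sIs index_mem.
  by rewrite (perm_mem Isp) mem_iota.
have phi_h O : O \in sg -> phi O \in porbits h.
  by move=> Og; rewrite -mem_enum mem_nth ?Is_lt.
have phi_card O : O \in sg -> #|phi O| = #|O|.
  move=> Og; have := congr1 (fun s => nth 0%N s (index O sg)) Eg.
  rewrite (nth_map set0) ?index_mem // nth_index // => ->.
  by rewrite (nth_map 0%N) ?sIs ?index_mem // (nth_map set0) ?Is_lt.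
have phi_inj : {in sg &, injective phi}.
  move=> O O' Og Og' /eqP; rewrite nth_uniq ?Is_lt ?enum_uniq //.
  rewrite nth_uniq ?sIs ?index_mem //; last by rewrite (perm_uniq Isp) iota_uniq.
  by move/eqP => E; rewrite -(nth_index set0 Og) E nth_index.
pose rep (O : {set T}) := odflt x0 [pick y in O].
have repP k O : O \in porbits k -> porbit k (rep O) = O.
  case/imsetP=> x _ ->; rewrite /rep; case: pickP => [y|/(_ x)]; last by rewrite porbit_id.
  by rewrite -eq_porbit_mem => /eqP.
have sgP x : porbit g x \in sg by rewrite mem_enum imset_f.
have repr_iter x : exists i, x = iter i g (rep (porbit g x)).
  have : x \in porbit g (rep (porbit g x)) by rewrite repP ?imset_f // porbit_id.
  by case/porbitP => i; rewrite permX; exists i.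
have porbit_iter k i x : porbit k (iter i k x) = porbit k x.
  by rewrite -permX porbit_perm.
pose idx x := index x (traject g (rep (porbit g x)) #|porbit g x|).
pose f x := iter (idx x) h (rep (phi (porbit g x))).
have idxP x : iter (idx x) g (rep (porbit g x)) = x.
  have xt : x \in traject g (rep (porbit g x)) #|porbit g x|.
    by have := porbit_traject g (rep (porbit g x)) x; rewrite repP ?imset_f // porbit_id => <-.
  have lt : (idx x < #|porbit g x|)%N.
    by move: xt; rewrite -index_mem size_traject.
  by rewrite -(nth_traject g lt) nth_index.
(* Matched orbits have equal size, so coincidence of iterates is the same congruence for both; this
   makes [f] independent of the chosen exponent. *)
have same O i j : O \in sg ->
    (iter i h (rep (phi O)) == iter j h (rep (phi O))) = (iter i g (rep O) == iter j g (rep O)).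
  move=> Og; rewrite !eq_iter_porbit !repP ?phi_card ?phi_h //.
  by rewrite -mem_enum.
have fE x i : f (iter i g (rep (porbit g x))) = iter i h (rep (phi (porbit g x))).
  set r := rep _; have Er : porbit g (iter i g r) = porbit g x.
    by rewrite porbit_iter repP ?imset_f.
  have := idxP (iter i g r); rewrite /f Er -/r => /eqP.
  by rewrite -same ?sgP // => /eqP.
have finj : injective f.
  move=> x y; have := fE x; have := fE y.
  have [i xi] := repr_iter x; have [j yj] := repr_iter y.
  move=> /(_ j); rewrite -yj => -> /(_ i); rewrite -xi => -> E.
  have Oxy : porbit g x = porbit g y.
    apply: phi_inj; rewrite ?sgP //.
    have := congr1 (porbit h) E; rewrite !porbit_iter !repP ?phi_h ?sgP //.
  move/eqP: E; rewrite Oxy same ?sgP // => /eqP E.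
  by rewrite xi yj Oxy E.
exists (perm finj); apply/permP => y.
rewrite -(permKV (perm finj) y); set x := ((perm finj)^-1)%g y.
rewrite permJ !permE; have [i xi] := repr_iter x.
have := fE x i.+1; rewrite iterS -xi => ->.
by have := fE x i; rewrite -xi => ->.
Qed.

Lemma sum_card_porbits g :
  sumn (map (fun O : {set T} => #|O|) (enum (porbits g))) = #|T|.
Proof.
rewrite sumnE big_map big_enum /= -sum1_card (partition_big_imset (porbit g)) /=.
apply: eq_bigr => _ /imsetP[x _ ->]; rewrite -sum1_card; apply: eq_bigl => y.
by rewrite eq_porbit_mem.
Qed.

End CycleType.

Section CycleTypeList.

Variable n : nat.
Implicit Types g h : 'S_n.

Definition ctype g : seq nat :=
  sort (fun a b : nat => (b <= a)%N) (map (fun O : {set 'I_n} => #|O|) (enum (porbits g))).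

Lemma ctype_partition g : is_partition n (ctype g).
Proof.
apply/and3P; split.
- by apply: sort_sorted => x y; apply: leq_total.
- rewrite all_sort; apply/allP => _ /mapP[O /[!mem_enum] /imsetP[x _ ->] ->].
  by rewrite lt0n card_porbit_neq0.
- by rewrite (perm_sumn (permEl (perm_sort _ _))) sum_card_porbits card_ord.
Qed.

Lemma ctype_conj g h : ctype g = ctype h -> exists x, h = (g ^ x)%g.
Proof.
move=> E; apply: perm_eq_card_porbits_conj.
by rewrite -(perm_sort (fun a b : nat => (b <= a)%N)) -/(ctype g) E perm_sort.
Qed.

(** The entries serve both as labels of conjugacy classes and as shapes of tableaux, so the two
    families have equal size by construction. *)
Definition ctypes : seq (seq nat) := undup [seq ctype g | g <- enum 'S_n].

Lemma ctypesP la : la \in ctypes -> exists g, ctype g = la.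
Proof. by rewrite mem_undup => /mapP[g _ ->]; exists g. Qed.

Lemma mem_ctype g : ctype g \in ctypes.
Proof. by rewrite mem_undup map_f // mem_enum. Qed.

Lemma ctypes_partition la : la \in ctypes -> is_partition n la.
Proof. by case/ctypesP => g <-; apply: ctype_partition. Qed.

End CycleTypeList.


(** * Characters of the symmetric group *)

Section SubmoduleTrace.

Variables (F : fieldType) (k : nat) (U G : 'M[F]_k) (c : F).

(** Up to the factor [c], the matrix [U] is a projection onto its row space, and it commutes with
    [G]. *)
Lemma mxtrace_submod : c != 0 -> U *m U = c *: U -> U *m G = G *m U ->
  \tr (in_submod U (val_submod (U := U) 1%:M *m G)) = c^-1 * \tr (U *m G).
Proof.
move=> c0 UU UG; set P := val_submod 1%:M; set Z := in_submod _ _.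
have /submxP[D PD] : (P <= U)%MS by rewrite val_submodP.
have /submxP[Q UQ] : (U <= P)%MS by rewrite /P val_submod1.
have P_free : row_free P by rewrite /row_free /P val_submod1.
have ZP : Z *m P = P *m G.
  rewrite -val_submodE in_submodK //; apply/submxP; exists (D *m G).
  by rewrite PD -!mulmxA UG.
have PQ : P *m Q = c%:M.
  apply: (row_free_inj P_free); rewrite -mulmxA -UQ mul_scalar_mx.
  by rewrite {1}PD -mulmxA UU -scalemxAr -PD.
apply: (mulfI c0); rewrite mulVKf // [X in _ = \tr (X *m _)]UQ -mulmxA -ZP.
rewrite [RHS]mxtrace_mulC -mulmxA.
by rewrite PQ mul_mx_scalar mxtraceZ.
Qed.

End SubmoduleTrace.

Lemma partition_eq_nth n m la mu : is_partition n la -> is_partition m mu ->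
  (forall i, nth 0%N la i = nth 0%N mu i) -> la = mu.
Proof.
move=> /and3P[_ /allP la0 _] /and3P[_ /allP mu0 _] E.
have size_le (s t : seq nat) : (forall i, nth 0%N s i = nth 0%N t i) ->
    {in t, forall a, (0 < a)%N} -> (size t <= size s)%N.
  move=> st t0; rewrite leqNgt; apply/negP => lt.
  by have := t0 _ (mem_nth 0%N lt); rewrite -st nth_default.
apply: (@eq_from_nth _ 0%N) => // .
by apply/eqP; rewrite eqn_leq !size_le // => i; rewrite E.
Qed.

Section TableauPairs.

Variable n : nat.

Lemma trow_card la : is_partition n la ->
  forall r, #|[set k : 'I_n | trow la k == r]| = nth 0%N la r.
Proof.
move=> la_part r; apply/eqP; rewrite eqn_leq; apply/andP; split.
  have col_lt (k : 'I_n) : k \in [set k : 'I_n | trow la k == r] -> (tcol la k < nth 0%N la r)%N.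
    by rewrite inE => /eqP <-; apply: tcell_lt.
  rewrite cardE -(size_map (tcol la)) -[leqRHS](size_iota 0).
  apply: uniq_leq_size.
    rewrite map_inj_in_uniq ?enum_uniq // => k l; rewrite !mem_enum !inE => /eqP kr /eqP lr.
    by apply: tcell_inj; rewrite kr lr.
  by move=> c /mapP[k]; rewrite mem_enum mem_iota => /col_lt lt ->.
have cell (c : 'I_(nth 0%N la r)) : exists k : 'I_n, trow la k = r /\ tcol la k = c.
  exact: tcell_exists.
have [f fE] := fin_all_exists cell.
have finj : injective f.
  by move=> c c' E; apply: val_inj; rewrite /= -(proj2 (fE c)) -(proj2 (fE c')) E.
rewrite -[leqLHS]card_ord -cardsT -(card_imset _ finj).
apply/subset_leq_card/subsetP => _ /imsetP[c _ ->]; rewrite inE.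
by have [-> _] := fE c.
Qed.

(** Antisymmetry of the dominance order: successive differences of the counts are the row
    lengths. *)
Lemma trow_dominance_anti la mu : is_partition n la -> is_partition n mu ->
  (forall r, #|[set k : 'I_n in setT | (trow la k < r)%N]|
           = #|[set k : 'I_n in setT | (trow mu k < r)%N]|) -> la = mu.
Proof.
move=> la_part mu_part E.
have rowS nu r : is_partition n nu ->
    (#|[set k : 'I_n in setT | (trow nu k < r.+1)%N]|
     = #|[set k : 'I_n in setT | (trow nu k < r)%N]| + nth 0%N nu r)%N.
  move=> nu_part; rewrite -(trow_card nu_part) -(cardsID [set k : 'I_n | trow nu k == r]) addnC.
  congr (_ + _)%N; apply: eq_card => k; rewrite !inE /= ltnS.
    by rewrite [in RHS]ltn_neqAle.
  by case: eqP => [->|]; rewrite ?leqnn ?andbF.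
apply: (partition_eq_nth la_part mu_part) => r.
by have := E r.+1; rewrite !rowS // E => /addnI.
Qed.

Variable F : fieldType.
Hypothesis F0 : [pchar F] =i pred0.

Definition young_prod_zero la mu := forall k (rho : 'S_n -> 'M[F]_k),
  (forall g h, rho (g * h)%g = rho g *m rho h) -> forall g,
  yelt setT rho (trow la) (tcol la) *m rho g *m yelt setT rho (trow mu) (tcol mu) = 0.

(** If every permutation makes two elements of a row of [la] fall into one column of [mu], all terms
    of the expanded product cancel. A permutation without such a clash is what [dominance] asks
    for. *)
Lemma young_prod_zero_or_dominance la mu : is_partition n mu ->
  young_prod_zero la mu \/
  forall r, (#|[set k : 'I_n in setT | (trow la k < r)%N]|
             <= #|[set k : 'I_n in setT | (trow mu k < r)%N]|)%N.
Proof.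
move=> mu_part.
pose clash (g : 'S_n) := [exists i, exists j,
  [&& i != j, trow la i == trow la j & tcol mu (g i) == tcol mu (g j)]].
have [/forallP all_clash|/forallPn[g noclash]] := boolP [forall g, clash g]; [left|right].
  move=> k rho rhoM g.
  have -> : yelt setT rho (trow la) (tcol la) *m rho g *m yelt setT rho (trow mu) (tcol mu)
     = rsum setT rho (trow la) *m (csum setT rho (tcol la) *m rho g *m rsum setT rho (trow mu))
        *m csum setT rho (tcol mu).
    by rewrite /yelt !mulmxA.
  have -> : csum setT rho (tcol la) *m rho g *m rsum setT rho (trow mu)
     = \sum_(q in fstab setT (tcol la)) \sum_(p in fstab setT (trow mu))
         (-1) ^+ (odd_perm q) *: rho (q * g * p)%g.
    rewrite !mulmx_suml; apply: eq_bigr => q _; rewrite mulmx_sumr.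
    by apply: eq_bigr => p _; rewrite -!scalemxAl !rhoM.
  have key x : rsum setT rho (trow la) *m rho x *m csum setT rho (tcol mu) = 0.
    case/existsP: (all_clash x) => i /existsP[j /and3P[ij /eqP r /eqP c]].
    by apply: (rsum_csum_eq0 rhoM F0 (perm_onT x) _ _ ij r c); rewrite inE.
  move: (rsum _ _ _) (csum _ _ _) key => R C key.
  rewrite mulmx_sumr mulmx_suml big1 // => q _.
  rewrite mulmx_sumr mulmx_suml big1 // => p _.
  by rewrite -scalemxAr -scalemxAl key scaler0.
apply: (@dominance n setT (trow la) (trow mu) (tcol mu) g); rewrite ?perm_onT //.
  by apply: tableau_diagram => // k l; rewrite !inE.
move=> x y _ _ r c; apply: contraNeq noclash => xy.
by apply/existsP; exists x; apply/existsP; exists y; rewrite xy r c !eqxx.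
Qed.

Lemma young_orthogonal la mu : is_partition n la -> is_partition n mu -> la != mu ->
  young_prod_zero la mu \/ young_prod_zero mu la.
Proof.
move=> la_part mu_part ne.
case: (young_prod_zero_or_dominance la mu_part) => [|lm]; first by left.
case: (young_prod_zero_or_dominance mu la_part) => [|ml]; first by right.
case/eqP: ne; apply: trow_dominance_anti => // r.
by apply/eqP; rewrite eqn_leq lm ml.
Qed.

End TableauPairs.

Section Characters.

Variables (F : fieldType) (n : nat).
Hypothesis F0 : [pchar F] =i pred0.
Implicit Types (g h t : 'S_n) (la mu : seq nat).

Definition ycf la g := ycoef F setT (trow la) (tcol la) g.
Definition ysc la g := yscal F setT (trow la) (tcol la) g.
Definition ygam la := ysc la 1%g.
Definition yelT k (rho : 'S_n -> 'M[F]_k) la := yelt setT rho (trow la) (tcol la).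
(** Coefficients of the sum of all conjugates of the symmetrizer, a central element of the group
    algebra. *)
Definition zcf la g := \sum_h ycf la (h^-1 * g * h)%g.

Lemma tableau_diagramT la : is_partition n la -> diagram [set: 'I_n] (trow la) (tcol la).
Proof. by move=> la_part; apply: tableau_diagram => // k l; rewrite !inE. Qed.

Section Rep.

Variables (k : nat) (rho : 'S_n -> 'M[F]_k).
Hypothesis rhoM : forall g h, rho (g * h)%g = rho g *m rho h.
Hypothesis rho1 : rho 1%g = 1%:M.

Lemma yelT_mul la g : is_partition n la ->
  yelT rho la *m rho g *m yelT rho la = ysc la g *: yelT rho la.
Proof. by move=> la_part; apply: yelt_mul_yelt (tableau_diagramT la_part) _ (perm_onT g). Qed.

Lemma yelT_sq la : is_partition n la -> yelT rho la *m yelT rho la = ygam la *: yelT rho la.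
Proof. by move=> la_part; rewrite -[X in X *m _]mulmx1 -rho1 yelT_mul. Qed.

Lemma zcf_lin la : \sum_g zcf la g *: rho g = \sum_h rho h *m yelT rho la *m rho h^-1%g.
Proof.
under eq_bigr => g _ do rewrite scaler_suml.
rewrite exchange_big; apply: eq_bigr => h _.
rewrite /yelT (yeltE _ rhoM) mulmx_sumr mulmx_suml (reindex_inj (conjg_inj h^-1%g)) /=.
apply: eq_bigr => g _; rewrite -scalemxAr -scalemxAl -!rhoM /conjg invgK.
by rewrite !mulgA mulVg mul1g mulgKV.
Qed.

End Rep.

Lemma zcf_conj la g x : zcf la (g ^ x)%g = zcf la g.
Proof.
rewrite /zcf (reindex_inj (mulgI x^-1)%g) /=; apply: eq_bigr => h _.
by congr ycf; rewrite /conjg invMg invgK !mulgA mulgK mulgK.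
Qed.

Local Notation reg := (@regmx F n).
Let regM := @regmxM F n.

Lemma mxtrace_yelT_reg la h : \tr (yelT reg la *m reg h^-1%g) = (ngr n)%:R * ycf la h.
Proof.
rewrite /yelT (yeltE _ regM) mulmx_suml -[RHS](congr1 (fun x => _ * ycf la x) (mul1g h)).
rewrite -(mxtrace_regmx_lin (fun g => ycf la (g * h)%g)); congr (\tr _).
rewrite [RHS](reindex_inj (mulIg h^-1%g)) /=; apply: eq_bigr => g _.
by rewrite -scalemxAl -regM mulgKV.
Qed.

Lemma ycf1 la : is_partition n la -> ycf la 1%g = 1.
Proof. by move=> la_part; apply: ycoef1; apply: tableau_diagramT. Qed.

(** The trace of the symmetrizer in the regular representation is n!, and it is also [ygam la] times
    its rank. *)
Lemma ygam_neq0 la : is_partition n la -> ygam la != 0.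
Proof.
move=> la_part; have := mxtrace_quasi_idempotent (yelT_sq regM (regmx1 F n) la_part).
rewrite -[X in \tr X]mulmx1 -(regmx1 F n) -[X in regmx F X]invg1 mxtrace_yelT_reg ycf1 // mulr1.
move=> E; apply: contraNneq (ngr_neq0 n F0) => g0.
by rewrite E g0 mul0r.
Qed.

(** The cube of the symmetrizer computed in two ways: by squaring twice, and by expanding the middle
    factor. *)
Lemma sum_ycf_ysc la : is_partition n la -> \sum_h ycf la h * ysc la h = ygam la ^+ 2.
Proof.
move=> la_part; have E0 : yelT reg la != 0.
  apply: contraNneq (ngr_neq0 n F0) => E0.
  by have := mxtrace_yelT_reg la 1%g; rewrite E0 mul0mx mxtrace0 ycf1 // mulr1 => <-.
have : (\sum_h ycf la h * ysc la h) *: yelT reg la = ygam la ^+ 2 *: yelT reg la.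
  have <- : yelT reg la *m yelT reg la *m yelT reg la = ygam la ^+ 2 *: yelT reg la.
    by rewrite (yelT_sq regM) ?regmx1 // -scalemxAl (yelT_sq regM) ?regmx1 // scalerA -expr2.
  rewrite {3}/yelT (yeltE _ regM) mulmx_sumr mulmx_suml scaler_suml.
  apply: eq_bigr => g _; rewrite -scalemxAr -scalemxAl.
  by rewrite (yelT_mul regM) // scalerA.
move/eqP; rewrite -subr_eq0 -scalerBl scaler_eq0 (negPf E0) orbF subr_eq0.
by move/eqP.
Qed.

Definition zmx la := \sum_h reg h *m yelT reg la *m reg h^-1%g.

Lemma zmx_comm la g : zmx la *m reg g = reg g *m zmx la.
Proof.
rewrite /zmx mulmx_suml mulmx_sumr [LHS](reindex_inj (mulgI g)) /=; apply: eq_bigr => h _.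
by rewrite invMg !regM -!mulmxA -regM mulVg regmx1 mulmx1.
Qed.

Lemma yelT_zmx_comm la mu : zmx la *m yelT reg mu = yelT reg mu *m zmx la.
Proof.
rewrite /yelT (yeltE _ regM) mulmx_sumr mulmx_suml; apply: eq_bigr => g _.
by rewrite -scalemxAr -scalemxAl zmx_comm.
Qed.

(** [young_orthogonal] gives vanishing in one of the two orders only; centrality of [zmx] makes
    either order sufficient. *)
Lemma yelT_zmx_eq0 la mu : is_partition n la -> is_partition n mu -> la != mu ->
  yelT reg la *m zmx mu = 0.
Proof.
move=> la_part mu_part ne; case: (young_orthogonal F0 la_part mu_part ne) => Z.
  rewrite /zmx mulmx_sumr big1 // => h _.
  rewrite (mulmxA (yelT reg la) (reg h *m yelT reg mu)) (mulmxA (yelT reg la) (reg h)).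
  by rewrite [X in X *m _](Z _ _ regM) mul0mx.
rewrite -yelT_zmx_comm /zmx mulmx_suml big1 // => h _.
rewrite -(mulmxA (reg h)) -(mulmxA (reg h)).
by rewrite [X in _ *m X](Z _ _ regM) mulmx0.
Qed.

Lemma zmx_orth la mu : is_partition n la -> is_partition n mu -> la != mu ->
  zmx la *m zmx mu = 0.
Proof.
move=> la_part mu_part ne; rewrite {1}/zmx mulmx_suml big1 // => h _.
by rewrite -mulmxA -zmx_comm mulmxA -(mulmxA (reg h)) yelT_zmx_eq0 // mulmx0 mul0mx.
Qed.

Lemma mxtrace_zmx la : is_partition n la -> \tr (zmx la) != 0.
Proof.
move=> la_part; rewrite /zmx -(zcf_lin regM) mxtrace_regmx_lin /zcf.
rewrite (eq_bigr (fun=> 1)) => [|h _]; last by rewrite mulg1 mulVg ycf1.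
by rewrite sumr_const mulf_neq0 ?ngr_neq0.
Qed.

Let p := size (ctypes n).
Let part (i : 'I_p) := nth [::] (ctypes n) i.

Let part_mem i : part i \in ctypes n.
Proof. exact: mem_nth. Qed.

Let part_part i : is_partition n (part i).
Proof. exact: ctypes_partition (part_mem i). Qed.

Let part_neq i j : i != j -> part i != part j.
Proof. by move=> ij; rewrite nth_uniq // undup_uniq. Qed.

(** Multiplying a relation by [zmx (part j)] leaves only its square, which is nonzero because an
    element of square zero would have trace zero. *)
Lemma zcf_free (b : 'I_p -> F) :
  (forall g, \sum_i b i * zcf (part i) g = 0) -> forall j, b j = 0.
Proof.
move=> b0 j; have : \sum_i b i *: zmx (part i) = 0.
  rewrite (eq_bigr (fun i => \sum_g (b i * zcf (part i) g) *: reg g)) => [|i _].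
    rewrite exchange_big big1 // => g _.
    by rewrite -scaler_suml b0 scale0r.
  rewrite /zmx -(zcf_lin regM) scaler_sumr.
  by apply: eq_bigr => g _; rewrite scalerA.
move/(congr1 (mulmx (zmx (part j)))); rewrite mulmx0 mulmx_sumr (bigD1 j) //= big1 => [|i ij].
  rewrite addr0 -scalemxAr => /eqP; rewrite scaler_eq0 => /orP[/eqP //|/eqP zz].
  have := mxtrace_quasi_idempotent (c := 0) (etrans zz (esym (scale0r _))).
  by move/eqP; rewrite mul0r (negPf (mxtrace_zmx _)).
by rewrite -scalemxAr zmx_orth ?scaler0 ?part_neq // eq_sym.
Qed.

(* There are as many central elements zmx as conjugacy classes, so they span
   the class functions. *)
Lemma zcf_span : exists b : 'I_p -> F,
  forall g, \sum_i b i * zcf (part i) g = (g == 1%g)%:R.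
Proof.
have [gp gpE] : exists gp : 'I_p -> 'S_n, forall j, ctype (gp j) = part j.
  by apply: (@fin_all_exists _ _ (fun j g => ctype g = part j)) => j; apply: ctypesP.
have gp_conj g : exists j x, g = (gp j ^ x)%g.
  have idx : (index (ctype g) (ctypes n) < p)%N by rewrite index_mem mem_ctype.
  exists (Ordinal idx); apply: ctype_conj; rewrite gpE.
  by rewrite /part nth_index // mem_ctype.
(* A square matrix, since shapes and class representatives share one index set; [zcf_free] makes it
   invertible. *)
pose M : 'M[F]_p := \matrix_(i, j) zcf (part i) (gp j).
have M_unit : M \in unitmx.
  rewrite -row_free_unit -kermx_eq0; apply/rowV0P => b /sub_kermxP bM.
  apply/rowP => j; rewrite mxE; apply: (zcf_free (b := fun i => b 0 i)) => g.
  have [l [x ->]] := gp_conj g; move/matrixP/(_ 0 l): bM; rewrite !mxE => bM; rewrite -[RHS]bM.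
  by apply: eq_bigr => i _; rewrite zcf_conj !mxE.
pose b := (\row_j (gp j == 1%g)%:R : 'rV[F]_p) *m invmx M.
have bM : b *m M = \row_j (gp j == 1%g)%:R by rewrite mulmxKV.
exists (fun i => b 0 i) => g; have [l [x ->]] := gp_conj g.
have -> : (gp l ^ x == 1)%g = (gp l == 1%g) by rewrite conjg_eq1.
move/matrixP/(_ 0 l): bM; rewrite !mxE => bM; rewrite -[RHS]bM.
by apply: eq_bigr => i _; rewrite zcf_conj !mxE.
Qed.

(** In other words [specht] is the matrix of left multiplication by the symmetrizer; hence it
    commutes with right translations and is quasi-idempotent. *)
Lemma spechtE la i j : is_partition n la ->
  specht F n la i j = ycf la (enum_val j * (enum_val i)^-1)%g.
Proof.
move=> la_part; rewrite !mxE (bigD1 (enum_rank (enum_val j * (enum_val i)^-1)%g)) //=.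
rewrite big1 => [|l lne]; last first.
  rewrite !mxE; case: eqP => [E|]; last by rewrite mulr0.
  by rewrite -E mulgK enum_valK eqxx in lne.
by rewrite !mxE enum_rankK mulgKV eqxx mulr1 addr0 row_stabE col_stabE.
Qed.

Lemma specht_comm la g : is_partition n la ->
  specht F n la *m regmx F g = regmx F g *m specht F n la.
Proof.
move=> la_part; apply/matrixP => i j; rewrite !mxE.
rewrite (bigD1 (enum_rank (enum_val j * g^-1)%g)) //= big1 => [|l lne]; last first.
  rewrite [regmx F g _ _]mxE; case: eqP => [E|]; last by rewrite mulr0.
  by rewrite -E mulgK enum_valK eqxx in lne.
rewrite [RHS](bigD1 (enum_rank (enum_val i * g)%g)) //=.
rewrite [X in _ = _ + X]big1 => [|l lne]; last first.
  rewrite [regmx F g _ _]mxE; case: eqP => [E|]; last by rewrite mul0r.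
  by rewrite E enum_valK eqxx in lne.
rewrite !spechtE // !mxE !enum_rankK mulgKV !eqxx mulr1 mul1r !addr0.
by rewrite invMg mulgA.
Qed.

Lemma ycf_conv la g : is_partition n la ->
  \sum_h ycf la h * ycf la (h^-1 * g)%g = ygam la * ycf la g.
Proof.
move=> la_part; have := yelT_sq regM (regmx1 F n) la_part.
move/matrixP/(_ (enum_rank 1%g) (enum_rank g)).
rewrite /yelT (yeltE _ regM) mxE [in RHS]mxE regmx_lin !enum_rankK invg1 mul1g => <-.
rewrite (reindex_onto enum_rank enum_val) /=; last by move=> i _; rewrite enum_valK.
apply: eq_big => [h|h _]; first by rewrite enum_rankK eqxx.
by rewrite !regmx_lin !enum_rankK invg1 mul1g.
Qed.

Lemma specht_sq la : is_partition n la ->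
  specht F n la *m specht F n la = ygam la *: specht F n la.
Proof.
move=> la_part; apply/matrixP => i j; rewrite mxE [in RHS]mxE spechtE //.
rewrite -ycf_conv // (reindex_onto enum_rank enum_val) /=; last by move=> l _; rewrite enum_valK.
rewrite (reindex_inj (inj_comp (mulIg (enum_val i))
  (inj_comp (mulIg (enum_val j * (enum_val i)^-1)%g) invg_inj))) /=.
apply: eq_big => [h|h _]; first by rewrite enum_rankK eqxx.
by rewrite !spechtE // !enum_rankK mulrC !invMg !invgK !mulgA mulgKV mulgV mul1g mulgK.
Qed.

Lemma irrcharE la t : is_partition n la ->
  irrchar F la t = (ygam la)^-1 * \tr (specht F n la *m regmx F t).
Proof.
move=> la_part; apply: mxtrace_submod; rewrite ?ygam_neq0 ?specht_sq //.
exact: specht_comm.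
Qed.

(** The left trace is that of x -> e_la x e_mu on the group algebra. It sums the coefficients at 1
    of e_la g e_mu g^-1 over all g, that is, the coefficient at 1 of e_la times the central
    element. *)
Lemma mxtrace_specht_yelT la mu : is_partition n la ->
  (ngr n)%:R * \tr (specht F n la *m yelT reg mu) = \tr (yelT reg la *m zmx mu).
Proof.
move=> la_part.
have -> : yelT reg la *m zmx mu = \sum_g (\sum_h ycf la h * zcf mu (h^-1 * g)%g) *: reg g.
  rewrite /zmx -(zcf_lin regM) /yelT (yeltE _ regM) mulmx_suml.
  under [RHS]eq_bigr => g _ do rewrite scaler_suml.
  rewrite exchange_big; apply: eq_bigr => h _; rewrite mulmx_sumr.
  rewrite [RHS](reindex_inj (mulgI h)); apply: eq_bigr => g _.
  by rewrite -scalemxAl -scalemxAr -regM scalerA mulKg.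
rewrite mxtrace_regmx_lin; congr (_ * _).
rewrite /mxtrace (reindex_onto enum_rank enum_val) /=; last by move=> i _; rewrite enum_valK.
transitivity (\sum_g \sum_h ycf la h * ycf mu (g^-1 * h^-1 * g)%g); last first.
  rewrite exchange_big; apply: eq_bigr => h _; rewrite mulg1 /zcf mulr_sumr.
  by apply: eq_bigr => g _.
apply: eq_big => [g|g _]; first by rewrite enum_rankK eqxx.
rewrite mxE (reindex_onto enum_rank enum_val) /=; last by move=> i _; rewrite enum_valK.
rewrite (reindex_inj (mulIg g)) /=; apply: eq_big => [h|h _]; first by rewrite enum_rankK eqxx.
rewrite spechtE // /yelT (yeltE _ regM) regmx_lin !enum_rankK mulgK invMg.
by [].
Qed.

Lemma mxtrace_specht_yelT_eq la mu : is_partition n la -> is_partition n mu ->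
  \tr (specht F n la *m yelT reg mu) = if la == mu then ygam la ^+ 2 else 0.
Proof.
move=> la_part mu_part; apply: (mulfI (ngr_neq0 n F0)); rewrite mxtrace_specht_yelT //.
case: eqP => [<-|/eqP ne]; last by rewrite yelT_zmx_eq0 // mxtrace0 mulr0.
rewrite -sum_ycf_ysc // mulr_sumr /zmx mulmx_sumr raddf_sum; apply: eq_bigr => h _ /=.
rewrite (mulmxA (yelT reg la) (reg h *m yelT reg la)) (mulmxA (yelT reg la) (reg h)).
by rewrite (yelT_mul regM) // -scalemxAl mxtraceZ mxtrace_yelT_reg mulrCA [ysc _ _ * _]mulrC.
Qed.

(** Insert 1 as the combination [bE] of central elements and reduce each term by e x e = [ysc] x e.
    The class functions obtained are independent of [rho] and [X]; [mxtrace_expansion] identifies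
    them as irreducible characters. *)
Lemma mxtrace_expansion_psi (b : 'I_p -> F) :
  (forall g, \sum_i b i * zcf (part i) g = (g == 1%g)%:R) ->
  forall k (rho : 'S_n -> 'M[F]_k) (X : 'M[F]_k) t,
  (forall g h, rho (g * h)%g = rho g *m rho h) -> rho 1%g = 1%:M ->
  (forall g, X *m rho g = rho g *m X) ->
  \tr (X *m rho t) = \sum_i (b i * \sum_h ysc (part i) (h^-1 * t * h)%g)
                        * ((ygam (part i))^-1 * \tr (X *m yelT rho (part i))).
Proof.
move=> bE k rho X t rhoM rho1 Xrho.
have E1 : 1%:M = \sum_i b i *: \sum_h rho h *m yelT rho (part i) *m rho h^-1%g.
  transitivity (\sum_g (\sum_i b i * zcf (part i) g) *: rho g).
    rewrite (bigD1 1%g) //= bE eqxx scale1r rho1 big1 ?addr0 // => g gne.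
    by rewrite bE (negPf gne) scale0r.
  under eq_bigr => g _ do rewrite scaler_suml.
  rewrite exchange_big; apply: eq_bigr => i _; rewrite -(zcf_lin rhoM) scaler_sumr.
  by apply: eq_bigr => g _; rewrite scalerA.
have Xy la : X *m yelT rho la = yelT rho la *m X.
  rewrite /yelT (yeltE _ rhoM) mulmx_sumr mulmx_suml; apply: eq_bigr => g _.
  by rewrite -scalemxAr -scalemxAl Xrho.
rewrite -[rho t]mul1mx {1}E1 mulmx_suml mulmx_sumr raddf_sum; apply: eq_bigr => i _ /=.
rewrite -scalemxAl -scalemxAr mxtraceZ -mulrA; congr (_ * _).
rewrite mulmx_suml mulmx_sumr raddf_sum mulr_suml; apply: eq_bigr => h _ /=.
have g0 := ygam_neq0 (part_part i); apply: (mulfI g0); rewrite [RHS]mulrCA mulVKf //.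
have := fun g => yelT_mul rhoM g (part_part i); have := yelT_sq rhoM rho1 (part_part i).
move: (yelT rho _) (Xy (part i)) => Y XY YY YxY.
have -> : X *m (rho h *m Y *m rho h^-1%g *m rho t) = rho h *m (X *m Y *m rho (h^-1 * t)%g).
  by rewrite rhoM !mulmxA Xrho.
rewrite mxtrace_mulC -!mulmxA -rhoM; set x := (_ * h)%g.
(* The factor [ygam] duplicates [Y]; by cyclicity of the trace and commutation with [X], the two
   copies come to enclose [rho x]. *)
rewrite -mxtraceZ scalemxAr scalemxAl -YY -mulmxA mulmxA [in LHS]XY -mulmxA [in LHS]mxtrace_mulC.
by rewrite -!mulmxA [in LHS](mulmxA Y) YxY -scalemxAr mxtraceZ.
Qed.

(** Apply [mxtrace_expansion_psi] to the regular representation with [specht] in place of [X]: by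
    orthogonality a single class function survives. Allowing any commuting [X] makes it possible to
    treat several commuting representations in turn. *)
Lemma mxtrace_expansion k (rho : 'S_n -> 'M[F]_k) (X : 'M[F]_k) t :
  (forall g h, rho (g * h)%g = rho g *m rho h) -> rho 1%g = 1%:M ->
  (forall g, X *m rho g = rho g *m X) ->
  \tr (X *m rho t) = \sum_(la <- ctypes n)
     irrchar F la t * ((ygam la)^-1 * \tr (X *m yelT rho la)).
Proof.
move=> rhoM rho1 Xrho; have [b bE] := zcf_span.
rewrite (mxtrace_expansion_psi bE _ rhoM) // (big_nth [::]) big_mkord.
apply: eq_bigr => i _; congr (_ * _); rewrite -/(part i) (irrcharE _ (part_part i)).
rewrite (mxtrace_expansion_psi bE _ regM (regmx1 F n)); last first.
  by move=> g; apply: specht_comm (part_part i).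
have g0 := ygam_neq0 (part_part i).
rewrite (bigD1 i) //= [X in _ * (_ + X)]big1 => [|j ji].
  rewrite mxtrace_specht_yelT_eq // eqxx addr0 mulrCA expr2.
  by rewrite mulKf // mulVf // mulr1.
by rewrite mxtrace_specht_yelT_eq // eq_sym (negPf (part_neq ji)) !mulr0.
Qed.

End Characters.


(** * The cocharacter *)

Section FactorAction.

Variables (F : fieldType) (k : nat) (W : 'M[F]_k).

Definition fact_mx (B : 'M[F]_k) : 'M[F]_(\rank (cokermx W)) :=
  in_factmod W (val_factmod (U := W) 1%:M *m B).

Lemma fact_mx_sum I r (c : I -> F) (B : I -> 'M[F]_k) :
  fact_mx (\sum_(i <- r) c i *: B i) = \sum_(i <- r) c i *: fact_mx (B i).
Proof.
rewrite /fact_mx mulmx_sumr linear_sum; apply: eq_bigr => i _ /=.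
by rewrite -scalemxAr linearZ.
Qed.

Lemma fact_mx1 : fact_mx 1%:M = 1%:M.
Proof. by rewrite /fact_mx mulmx1 val_factmodK. Qed.

Lemma fact_mx_eq0 B : (B <= W)%MS -> fact_mx B = 0.
Proof. by move=> BW; apply/eqP; rewrite in_factmod_eq0 (submx_trans (submxMl _ _)). Qed.

(** Projecting and lifting back changes a representative by an element of [W], which [C] keeps in
    [W] and the last projection kills. *)
Lemma fact_mxM B C : (W *m C <= W)%MS -> fact_mx (B *m C) = fact_mx B *m fact_mx C.
Proof.
move=> WC; pose P := val_factmod (U := W) 1%:M; pose Q := in_factmod W 1%:M.
have E D : fact_mx D = P *m D *m Q by rewrite /fact_mx in_factmodE.
have := add_sub_fact_mod W (P *m B); rewrite val_factmodE in_factmodE.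
set w := val_submod _; rewrite -/P -/Q => PB.
have : w *m C *m Q = 0.
  apply/eqP; rewrite -in_factmodE in_factmod_eq0; apply: submx_trans WC.
  by rewrite submxMr // val_submodP.
rewrite !E; move: @w PB {E} => /=; move: (val_submod _) => w; move: P Q => P Q PB wCQ.
by rewrite mulmxA -{1}PB !mulmxDl wCQ add0r !mulmxA.
Qed.

End FactorAction.

Lemma mulmx_quasi_idempotent (F : fieldType) k (B C : 'M[F]_k) (b c : F) :
  B *m B = b *: B -> C *m C = c *: C -> B *m C = C *m B ->
  (B *m C) *m (B *m C) = (b * c) *: (B *m C).
Proof.
move=> BB CC BC; rewrite {1}BC -!mulmxA [B *m (B *m C)]mulmxA BB -!scalemxAl -scalemxAr.
by rewrite mulmxA -BC -mulmxA CC -scalemxAr scalerA.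
Qed.

Lemma yelT_comm (F : fieldType) n k (rho : 'S_n -> 'M[F]_k) (B : 'M[F]_k) la :
  (forall g h, rho (g * h)%g = rho g *m rho h) ->
  (forall g, B *m rho g = rho g *m B) -> B *m yelT rho la = yelT rho la *m B.
Proof.
move=> rhoM Brho; rewrite /yelT (yeltE _ rhoM) mulmx_sumr mulmx_suml.
by apply: eq_bigr => g _; rewrite -scalemxAr -scalemxAl Brho.
Qed.

Section CommutingRepresentations.

Variables (F : fieldType) (k n1 n2 n3 n4 : nat).
Hypothesis F0 : [pchar F] =i pred0.
Variables (rho1 : 'S_n1 -> 'M[F]_k) (rho2 : 'S_n2 -> 'M[F]_k).
Variables (rho3 : 'S_n3 -> 'M[F]_k) (rho4 : 'S_n4 -> 'M[F]_k).
Hypothesis rho1M : forall g h, rho1 (g * h)%g = rho1 g *m rho1 h.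
Hypothesis rho2M : forall g h, rho2 (g * h)%g = rho2 g *m rho2 h.
Hypothesis rho3M : forall g h, rho3 (g * h)%g = rho3 g *m rho3 h.
Hypothesis rho4M : forall g h, rho4 (g * h)%g = rho4 g *m rho4 h.
Hypothesis rho11 : rho1 1%g = 1%:M.
Hypothesis rho21 : rho2 1%g = 1%:M.
Hypothesis rho31 : rho3 1%g = 1%:M.
Hypothesis rho41 : rho4 1%g = 1%:M.
Hypothesis c12 : forall g h, comm_mx (rho1 g) (rho2 h).
Hypothesis c13 : forall g h, comm_mx (rho1 g) (rho3 h).
Hypothesis c14 : forall g h, comm_mx (rho1 g) (rho4 h).
Hypothesis c23 : forall g h, comm_mx (rho2 g) (rho3 h).
Hypothesis c24 : forall g h, comm_mx (rho2 g) (rho4 h).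
Hypothesis c34 : forall g h, comm_mx (rho3 g) (rho4 h).

(** Up to a nonzero scalar a projection, for partitions of the right sizes; its rank is the
    multiplicity in the cocharacter. *)
Definition mult_mx (la : mpart) : 'M[F]_k :=
  let: (l1, l2, l3, l4) := la in
  yelT rho1 l1 *m (yelT rho2 l2 *m (yelT rho3 l3 *m yelT rho4 l4)).

Lemma comm_mxMr (B C D : 'M[F]_k) : comm_mx B D -> comm_mx C D -> comm_mx (B *m C) D.
Proof. by move=> BD CD; apply/comm_mx_sym/comm_mxM; apply/comm_mx_sym. Qed.

Lemma mxtrace_mult_mx l1 l2 l3 l4 : is_mpart n1 n2 n3 n4 (l1, l2, l3, l4) ->
  \tr (mult_mx (l1, l2, l3, l4)) =
  (ygam F n1 l1 * (ygam F n2 l2 * (ygam F n3 l3 * ygam F n4 l4)))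
  * (\rank (mult_mx (l1, l2, l3, l4)))%:R.
Proof.
case/and4P=> p1 p2 p3 p4; apply: mxtrace_quasi_idempotent.
have Y12 : comm_mx (yelT rho1 l1) (yelT rho2 l2).
  by apply: yelT_comm => // g; apply/esym/yelT_comm => // h; apply/esym/c12.
have Y13 : comm_mx (yelT rho1 l1) (yelT rho3 l3).
  by apply: yelT_comm => // g; apply/esym/yelT_comm => // h; apply/esym/c13.
have Y14 : comm_mx (yelT rho1 l1) (yelT rho4 l4).
  by apply: yelT_comm => // g; apply/esym/yelT_comm => // h; apply/esym/c14.
have Y23 : comm_mx (yelT rho2 l2) (yelT rho3 l3).
  by apply: yelT_comm => // g; apply/esym/yelT_comm => // h; apply/esym/c23.
have Y24 : comm_mx (yelT rho2 l2) (yelT rho4 l4).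
  by apply: yelT_comm => // g; apply/esym/yelT_comm => // h; apply/esym/c24.
have Y34 : comm_mx (yelT rho3 l3) (yelT rho4 l4).
  by apply: yelT_comm => // g; apply/esym/yelT_comm => // h; apply/esym/c34.
apply: mulmx_quasi_idempotent; first exact: yelT_sq.
  apply: mulmx_quasi_idempotent; first exact: yelT_sq.
    by apply: mulmx_quasi_idempotent => //; apply: yelT_sq.
  exact: comm_mxM.
exact: comm_mxM Y12 (comm_mxM Y13 Y14).
Qed.

(** Expand the fourth factor, then the third, second and first, keeping the remaining factors in the
    commuting matrix. The inverse constants [ygam] cancel against the trace of [mult_mx]. *)
Lemma mxtrace_four_expansion t1 t2 t3 t4 :
  \tr (rho1 t1 *m rho2 t2 *m rho3 t3 *m rho4 t4) =
  \sum_(l4 <- ctypes n4) \sum_(l3 <- ctypes n3) \sum_(l2 <- ctypes n2)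
    \sum_(l1 <- ctypes n1)
    (\rank (mult_mx (l1, l2, l3, l4)))%:R * mchar F (l1, l2, l3, l4) t1 t2 t3 t4.
Proof.
rewrite (mxtrace_expansion F0 t4 rho4M) //; last first.
  by move=> g; exact: comm_mxMr (comm_mxMr (c14 _ _) (c24 _ _)) (c34 _ _).
rewrite big_seq [RHS]big_seq; apply: eq_bigr => l4 /ctypes_partition p4.
have y14 g : comm_mx (yelT rho4 l4) (rho1 g).
  by apply/esym/yelT_comm => // h; apply: c14.
have y24 g : comm_mx (yelT rho4 l4) (rho2 g).
  by apply/esym/yelT_comm => // h; apply: c24.
have y34 g : comm_mx (yelT rho4 l4) (rho3 g).
  by apply/esym/yelT_comm => // h; apply: c34.
rewrite -mulmxA -(y34 t3) mulmxA (mxtrace_expansion F0 t3 rho3M) //; last first.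
  by move=> g; exact: comm_mxMr (comm_mxMr (c13 _ _) (c23 _ _)) (y34 g).
rewrite !mulr_sumr big_seq [RHS]big_seq; apply: eq_bigr => l3 /ctypes_partition p3.
have y13 g : comm_mx (yelT rho3 l3) (rho1 g).
  by apply/esym/yelT_comm => // h; apply: c13.
have y23 g : comm_mx (yelT rho3 l3) (rho2 g).
  by apply/esym/yelT_comm => // h; apply: c23.
have Y34 : comm_mx (yelT rho3 l3) (yelT rho4 l4).
  by apply/esym/yelT_comm => // h; apply: y34.
rewrite -mulmxA -Y34 -mulmxA -(comm_mxMr (y23 t2) (y24 t2)) mulmxA.
rewrite (mxtrace_expansion F0 t2 rho2M) //; last first.
  by move=> g; exact: comm_mxMr (c12 _ _) (comm_mxMr (y23 g) (y24 g)).
rewrite !mulr_sumr big_seq [RHS]big_seq; apply: eq_bigr => l2 /ctypes_partition p2.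
have y12 g : comm_mx (yelT rho2 l2) (rho1 g).
  by apply/esym/yelT_comm => // h; apply: c12.
have Y23 : comm_mx (yelT rho2 l2) (yelT rho3 l3).
  by apply/esym/yelT_comm => // h; apply: y23.
have Y24 : comm_mx (yelT rho2 l2) (yelT rho4 l4).
  by apply/esym/yelT_comm => // h; apply: y24.
have Y2 := comm_mxM Y23 Y24.
rewrite -mulmxA -Y2 -(comm_mxMr (y12 t1) (comm_mxMr (y13 t1) (y14 t1))).
rewrite (mxtrace_expansion F0 t1 rho1M) //; last first.
  by move=> g; exact: comm_mxMr (y12 g) (comm_mxMr (y13 g) (y14 g)).
rewrite !mulr_sumr big_seq [RHS]big_seq; apply: eq_bigr => l1 /ctypes_partition p1.
rewrite [\tr _]mxtrace_mulC -/(mult_mx (l1, l2, l3, l4)) mxtrace_mult_mx; last first.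
  by rewrite /= p1 p2 p3.
have := ygam_neq0 F0 p1; have := ygam_neq0 F0 p2.
have := ygam_neq0 F0 p3; have := ygam_neq0 F0 p4; rewrite /mchar.
move: (ygam _ _ _) (ygam _ _ _) (ygam _ _ _) (ygam _ _ _) (\rank _)%:R => g1 g2 g3 g4 r.
move=> h4 h3 h2 h1; field.
by rewrite h1 h2 h3.
Qed.

End CommutingRepresentations.

Section Monomials.

Variables (n1 n2 n3 n4 : nat).
Local Notation V := (Var n1 n2 n3 n4).

Lemma vactM (t1 s1 : 'S_n1) (t2 s2 : 'S_n2) (t3 s3 : 'S_n3) (t4 s4 : 'S_n4) (v : V) :
  vact (t1 * s1)%g (t2 * s2)%g (t3 * s3)%g (t4 * s4)%g v
  = vact s1 s2 s3 s4 (vact t1 t2 t3 t4 v).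
Proof. by case: v => [[[j|j]|j]|j] /=; rewrite permM. Qed.

Lemma vact1 (v : V) : vact 1%g 1%g 1%g 1%g v = v.
Proof. by case: v => [[[j|j]|j]|j] /=; rewrite perm1. Qed.

Lemma vact_inj (t1 : 'S_n1) (t2 : 'S_n2) (t3 : 'S_n3) (t4 : 'S_n4) :
  injective (vact t1 t2 t3 t4).
Proof.
by apply: (can_inj (g := vact t1^-1 t2^-1 t3^-1 t4^-1)%g) => v; rewrite -vactM !mulgV vact1.
Qed.

Definition vperm t1 t2 t3 t4 : {perm V} := perm (@vact_inj t1 t2 t3 t4).

Variable F : fieldType.

Lemma PactE t1 t2 t3 t4 i j : Pact F t1 t2 t3 t4 i j =
  ((enum_val i * vperm t1 t2 t3 t4)%g == enum_val j :> {perm V})%:R.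
Proof.
rewrite mxE; congr (nat_of_bool _)%:R; apply/forallP/eqP => [E|<- v].
  by apply/permP => v; rewrite permM permE; apply/esym/eqP.
by rewrite permM permE.
Qed.

Lemma PactM (t1 s1 : 'S_n1) (t2 s2 : 'S_n2) (t3 s3 : 'S_n3) (t4 s4 : 'S_n4) :
  Pact F (t1 * s1)%g (t2 * s2)%g (t3 * s3)%g (t4 * s4)%g
  = Pact F t1 t2 t3 t4 *m Pact F s1 s2 s3 s4.
Proof.
apply/matrixP => i j; rewrite PactE mxE.
rewrite (bigD1 (enum_rank (enum_val i * vperm t1 t2 t3 t4)%g)) //= !PactE.
rewrite enum_rankK eqxx mul1r big1 ?addr0 => [|l lne].
  congr (_ == _)%:R; apply/permP => v; by rewrite !permM !permE vactM.
rewrite PactE; case: eqP => [E|]; last by rewrite mul0r.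
by rewrite E enum_valK eqxx in lne.
Qed.

Lemma Pact1 : Pact F 1%g 1%g 1%g 1%g = 1%:M :> 'M_(nmon n1 n2 n3 n4).
Proof.
apply/matrixP => i j; rewrite PactE mxE -(inj_eq enum_val_inj).
congr (_ == _)%:R; apply/permP => v; by rewrite permM permE vact1.
Qed.

Variables (A : lmodType F) (mul : A -> A -> A).

Lemma meval_sum I r (c : I -> F) (f : I -> 'rV[F]_(nmon n1 n2 n3 n4)) (s : V -> A) :
  meval mul (\sum_(i <- r) c i *: f i) s = \sum_(i <- r) c i *: meval mul (f i) s.
Proof.
rewrite /meval; under eq_bigr => j _ do rewrite summxE scaler_suml.
rewrite exchange_big; apply: eq_bigr => i _; rewrite scaler_sumr.
by apply: eq_bigr => j _; rewrite mxE scalerA.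
Qed.

Lemma meval_row_Pact t1 t2 t3 t4 m (s : V -> A) :
  meval mul (row m (Pact F t1 t2 t3 t4)) s
  = wprod mul (map s (map (vact t1 t2 t3 t4) (monword m))).
Proof.
rewrite /meval (bigD1 (enum_rank (enum_val m * vperm t1 t2 t3 t4)%g)) //= big1 => [|l lne].
  rewrite mxE PactE enum_rankK eqxx scale1r addr0; congr (wprod mul (map s _)).
  rewrite /monword enum_rankK -[RHS]map_comp.
  by apply: eq_map => v; rewrite permM permE.
rewrite mxE PactE; case: eqP => [E|]; last by rewrite scale0r.
by rewrite E enum_valK eqxx in lne.
Qed.

Lemma meval_Pact t1 t2 t3 t4 f (s : V -> A) :
  meval mul (f *m Pact F t1 t2 t3 t4) s = meval mul f (s \o vact t1 t2 t3 t4).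
Proof.
rewrite mulmx_sum_row meval_sum; apply: eq_bigr => m _.
by rewrite meval_row_Pact -map_comp.
Qed.

Lemma Pact_stable (Agr : bool -> A -> Prop) (sh : A -> A) (W : 'M[F]_(nmon n1 n2 n3 n4)) :
  (forall f : 'rV[F]_(nmon n1 n2 n3 n4), (f <= W)%MS <-> is_sharp_id mul Agr sh f) ->
  forall t1 t2 t3 t4, (W *m Pact F t1 t2 t3 t4 <= W)%MS.
Proof.
move=> WP t1 t2 t3 t4; apply/row_subP => i; rewrite row_mul.
have /WP Wi := row_sub i W; apply/WP => s sadm; rewrite meval_Pact; apply: Wi => v /=.
by have := sadm (vact t1 t2 t3 t4 v); case: v => [[[j|j]|j]|j].
Qed.

End Monomials.

(** * Vanishing of multiplicities outside the hook *)

Section HookVanishing.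

Variables (F : fieldType) (A : lmodType F) (mul : A -> A -> A).
Hypothesis F0 : [pchar F] =i pred0.
Hypothesis mul_alg : is_assoc_algebra mul.
Variables (d : nat) (a : seq 'I_d.+1 -> F).
Hypothesis aP : multilinear_PI mul a.
Variable b : nat.
Hypothesis b_gt0 : (0 < b)%N.
Hypothesis b_big : (((d.+1 ^ 2) ^ 5) ^ b < b`!)%N.
Variables (Agr : bool -> A -> Prop) (sh : A -> A) (n1 n2 n3 n4 : nat).
Local Notation V := (Var n1 n2 n3 n4).
Variable W : 'M[F]_(nmon n1 n2 n3 n4).
Hypothesis WP : forall f : 'rV[F]_(nmon n1 n2 n3 n4),
  (f <= W)%MS <-> is_sharp_id mul Agr sh f.

(** The maps [f1] to [f4] insert S_n as one of the four factors and [i0] lists its variables, so one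
    argument covers all four types. A partition outside the hook contains the full b by 2b
    rectangle, whose symmetrizer turns every monomial into an identity. *)
Lemma hook_vanishing n (f1 : 'S_n -> 'S_n1) (f2 : 'S_n -> 'S_n2) (f3 : 'S_n -> 'S_n3)
    (f4 : 'S_n -> 'S_n4) (i0 : 'I_n -> V) (la : seq nat) :
  let act g := vact (f1 g) (f2 g) (f3 g) (f4 g) in
  let rho g := fact_mx W (Pact F (f1 g) (f2 g) (f3 g) (f4 g)) in
  injective i0 -> (forall g k, act g (i0 k) = i0 (g k)) ->
  (forall g v, (forall k, v != i0 k) -> act g v = v) ->
  (forall g h, rho (g * h)%g = rho g *m rho h) ->
  is_partition n la -> ~~ in_hook b (2 * b) la -> yelT rho la = 0.
Proof.
move=> act rho i0_inj act_i0 act_out rhoM la_part; rewrite /in_hook -ltnNge => /ltnW la_big.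
apply: (@yelt_sub_eq0 _ _ (rect n la b)) => //; rewrite (yeltE _ rhoM) -fact_mx_sum.
apply: fact_mx_eq0; apply/row_subP => m; apply/WP => s _.
rewrite (_ : row m _ = \sum_g ycoef F (rect n la b) (trow la) (tcol la) g *:
   row m (Pact F (f1 g) (f2 g) (f3 g) (f4 g))); last first.
  by rewrite linear_sum; apply: eq_bigr => g _; rewrite linearZ.
rewrite meval_sum; under eq_bigr => g _ do rewrite meval_row_Pact.
apply: (rect_word_annihilates F0 mul_alg aP b_gt0 b_big i0_inj act_i0 act_out) => //.
  by rewrite map_inj_uniq ?enum_uniq //; apply: perm_inj.
move=> v; apply/mapP; exists (((enum_val m : {perm V})^-1)%g v); first by rewrite mem_enum.
by rewrite permKV.
Qed.

Let rho1 t := fact_mx W (Pact F t (1%g : 'S_n2) (1%g : 'S_n3) (1%g : 'S_n4)).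
Let rho2 t := fact_mx W (Pact F (1%g : 'S_n1) t (1%g : 'S_n3) (1%g : 'S_n4)).
Let rho3 t := fact_mx W (Pact F (1%g : 'S_n1) (1%g : 'S_n2) t (1%g : 'S_n4)).
Let rho4 t := fact_mx W (Pact F (1%g : 'S_n1) (1%g : 'S_n2) (1%g : 'S_n3) t).

Let phiM t1 s1 t2 s2 t3 s3 t4 s4 :
  fact_mx W (Pact F (t1 * s1)%g (t2 * s2)%g (t3 * s3)%g (t4 * s4)%g)
  = fact_mx W (Pact F t1 t2 t3 t4) *m fact_mx W (Pact F s1 s2 s3 s4).
Proof. by rewrite PactM fact_mxM //; apply: Pact_stable WP _ _ _ _. Qed.

Let rho1M g h : rho1 (g * h)%g = rho1 g *m rho1 h.
Proof. by rewrite /rho1 -phiM !mulg1. Qed.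
Let rho2M g h : rho2 (g * h)%g = rho2 g *m rho2 h.
Proof. by rewrite /rho2 -phiM !mulg1. Qed.
Let rho3M g h : rho3 (g * h)%g = rho3 g *m rho3 h.
Proof. by rewrite /rho3 -phiM !mulg1. Qed.
Let rho4M g h : rho4 (g * h)%g = rho4 g *m rho4 h.
Proof. by rewrite /rho4 -phiM !mulg1. Qed.

Let rho11 : rho1 1%g = 1%:M. Proof. by rewrite /rho1 Pact1 fact_mx1. Qed.
Let rho21 : rho2 1%g = 1%:M. Proof. by rewrite /rho2 Pact1 fact_mx1. Qed.
Let rho31 : rho3 1%g = 1%:M. Proof. by rewrite /rho3 Pact1 fact_mx1. Qed.
Let rho41 : rho4 1%g = 1%:M. Proof. by rewrite /rho4 Pact1 fact_mx1. Qed.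

Let c12 g h : comm_mx (rho1 g) (rho2 h).
Proof. by rewrite /comm_mx /rho1 /rho2 -!phiM !mulg1 !mul1g. Qed.
Let c13 g h : comm_mx (rho1 g) (rho3 h).
Proof. by rewrite /comm_mx /rho1 /rho3 -!phiM !mulg1 !mul1g. Qed.
Let c14 g h : comm_mx (rho1 g) (rho4 h).
Proof. by rewrite /comm_mx /rho1 /rho4 -!phiM !mulg1 !mul1g. Qed.
Let c23 g h : comm_mx (rho2 g) (rho3 h).
Proof. by rewrite /comm_mx /rho2 /rho3 -!phiM !mulg1 !mul1g. Qed.
Let c24 g h : comm_mx (rho2 g) (rho4 h).
Proof. by rewrite /comm_mx /rho2 /rho4 -!phiM !mulg1 !mul1g. Qed.
Let c34 g h : comm_mx (rho3 g) (rho4 h).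
Proof. by rewrite /comm_mx /rho3 /rho4 -!phiM !mulg1 !mul1g. Qed.

Lemma mult_mx_out la : is_mpart n1 n2 n3 n4 la ->
  ~~ in_mhook b (2 * b) b (2 * b) b (2 * b) b (2 * b) la -> mult_mx rho1 rho2 rho3 rho4 la = 0.
Proof.
case: la => [[[l1 l2] l3] l4] /= /and4P[p1 p2 p3 p4]; rewrite !negb_and => /or4P[] h.
- rewrite (_ : yelT rho1 l1 = 0) ?mul0mx ?mulmx0 //.
  apply: (@hook_vanishing _ id (fun=> 1%g) (fun=> 1%g) (fun=> 1%g) (fun j => inl (inl (inl j))))
    => //=; first by move=> ? ? [].
  by move=> g [[[j|j]|j]|j] //= nv; rewrite ?perm1 //; have := nv j; rewrite eqxx.
- rewrite (_ : yelT rho2 l2 = 0) ?mul0mx ?mulmx0 //.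
  apply: (@hook_vanishing _ (fun=> 1%g) id (fun=> 1%g) (fun=> 1%g) (fun j => inl (inl (inr j))))
    => //=; first by move=> ? ? [].
  by move=> g [[[j|j]|j]|j] //= nv; rewrite ?perm1 //; have := nv j; rewrite eqxx.
- rewrite (_ : yelT rho3 l3 = 0) ?mul0mx ?mulmx0 //.
  apply: (@hook_vanishing _ (fun=> 1%g) (fun=> 1%g) id (fun=> 1%g) (fun j => inl (inr j)))
    => //=; first by move=> ? ? [].
  by move=> g [[[j|j]|j]|j] //= nv; rewrite ?perm1 //; have := nv j; rewrite eqxx.
- rewrite (_ : yelT rho4 l4 = 0) ?mul0mx ?mulmx0 //.
  apply: (@hook_vanishing _ (fun=> 1%g) (fun=> 1%g) (fun=> 1%g) id (fun j => inr j))
    => //=; first by move=> ? ? [].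
  by move=> g [[[j|j]|j]|j] //= nv; rewrite ?perm1 //; have := nv j; rewrite eqxx.
Qed.

Lemma cochar_in_hook : exists (L : seq mpart) (m : mpart -> nat),
  [/\ uniq L,
      all (fun la => is_mpart n1 n2 n3 n4 la &&
        in_mhook b (2 * b) b (2 * b) b (2 * b) b (2 * b) la) L &
      forall (t1 : 'S_n1) (t2 : 'S_n2) (t3 : 'S_n3) (t4 : 'S_n4),
        cochar W t1 t2 t3 t4 = \sum_(la <- L) (m la)%:R * mchar F la t1 t2 t3 t4].
Proof.
pose L : seq mpart := [seq (x, l4) | l4 <- ctypes n4,
  x <- [seq (y, l3) | l3 <- ctypes n3,
         y <- [seq (l1, l2) | l2 <- ctypes n2, l1 <- ctypes n1]]].
have Lpart la : la \in L -> is_mpart n1 n2 n3 n4 la.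
  case/allpairsP=> -[l4 x] /= [/ctypes_partition p4 xL ->].
  case/allpairsP: xL => -[l3 y] /= [/ctypes_partition p3 yL ->].
  case/allpairsP: yL => -[l2 l1] /= [/ctypes_partition p2 /ctypes_partition p1 ->].
  by rewrite /= p1 p2 p3.
pose hk := in_mhook b (2 * b) b (2 * b) b (2 * b) b (2 * b).
exists (filter hk L), (fun la => \rank (mult_mx rho1 rho2 rho3 rho4 la)); split.
- rewrite filter_uniq // !allpairs_uniq ?undup_uniq //.
  + by move=> [? ?] [? ?] _ _ /= [-> ->].
  + by move=> [? ?] [? ?] _ _ /= [-> ->].
  + by move=> [? ?] [? ?] _ _ /= [-> ->].
- by apply/allP => la; rewrite mem_filter => /andP[hla /Lpart ->].
move=> t1 t2 t3 t4.
have -> : cochar W t1 t2 t3 t4 = \tr (rho1 t1 *m rho2 t2 *m rho3 t3 *m rho4 t4).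
  by rewrite -!phiM !mulg1 !mul1g.
rewrite (mxtrace_four_expansion F0) //.
rewrite big_filter [RHS]big_mkcond [RHS]big_seq.
(* Shapes outside the quadruple hook may be restored to the sum, their multiplicity being the rank
   of a zero matrix. *)
rewrite (eq_bigr (fun la => (\rank (mult_mx rho1 rho2 rho3 rho4 la))%:R
   * mchar F la t1 t2 t3 t4)) => [|la /Lpart la_part]; last first.
  by case: ifP => // /negbT /(mult_mx_out la_part) ->; rewrite mxrank0 mul0r.
rewrite -big_seq /L big_allpairs_dep; apply: eq_bigr => l4 _.
rewrite big_allpairs_dep; apply: eq_bigr => l3 _.
by rewrite big_allpairs_dep.
Qed.

End HookVanishing.

Theorem theorem4p4 (F : fieldType) (A : lmodType F) (mul : A -> A -> A)
  (Agr : bool -> A -> Prop) (super : bool) (sh : A -> A) :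
  [pchar F] =i pred0 ->
  is_sharp_superalgebra mul Agr super sh ->
  is_PI mul ->
  exists d1 l1 d2 l2 d3 l3 d4 l4 : nat,
    forall (n1 n2 n3 n4 : nat) (W : 'M[F]_(nmon n1 n2 n3 n4)),
      (forall f : 'rV[F]_(nmon n1 n2 n3 n4),
          (f <= W)%MS <-> is_sharp_id mul Agr sh f) ->
      exists (L : seq mpart) (m : mpart -> nat),
        [/\ uniq L,
            all (fun la => is_mpart n1 n2 n3 n4 la && in_mhook d1 l1 d2 l2 d3 l3 d4 l4 la) L &
            forall (t1 : 'S_n1) (t2 : 'S_n2) (t3 : 'S_n3) (t4 : 'S_n4),
              cochar W t1 t2 t3 t4 = \sum_(la <- L) (m la)%:R * mchar F la t1 t2 t3 t4].
Proof.
move=> F0 [[mul_alg _ _ _ _] _] /(PI_multilinear F0 mul_alg)[d [a aP]].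
(* The base comes from the Latyshev constant of the identity, so [b] is fixed before the degrees
   [n1] to [n4]. *)
have [b b_gt0 b_big] := exp_lt_fact ((d.+1 ^ 2) ^ 5)%N.
exists b, (2 * b)%N, b, (2 * b)%N, b, (2 * b)%N, b, (2 * b)%N => n1 n2 n3 n4 W WP.
exact: (cochar_in_hook F0 mul_alg aP b_gt0 b_big WP).
Qed.
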